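(* Let $G=(V,E)$ be a finite graph, let $m_1,m_2\ge 1$ be integers, $p_1,p_2>1$ real numbers, $\lambda>0$ a parameter, $h_1,h_2:V\to(0,\infty)$, and let $F:V\times\mathbb{R}\times\mathbb{R}\to\mathbb{R}$ satisfy the following conditions. (a) There is a constant $\delta>0$ such that for all $x\in V$, $F(x,t,s)$ is continuously differentiable in $(t,s)\in\mathbb{R}\times\mathbb{R}$ with $|(t,s)|\le\delta$. (b) There exist $q_i>p_i$ and $M_i>0$, $i=1,2$, such that $F(x,t,s)\ge M_1|t|^{q_1}+M_2|s|^{q_2}$ for all $x\in V$ and $|(t,s)|\le\delta$. (c) There exist $k_i\in(p_i,q_i)$, $i=1,2$, satisfying $\min\{k_1,k_2\}>\max\{p_1,p_2\}$, and $M_3,M_4>0$ such that $$|F_t(x,t,s)|\le M_3|t|^{k_1-1}+M_4|s|^{\frac{k_2(k_1-1)}{k_1}},\qquad |F_s(x,t,s)|\le M_3|t|^{\frac{k_1(k_2-1)}{k_2}}+M_4|s|^{k_2-1}$$ for all $x\in V$ and $|(t,s)|\le\delta$, where $F_t=\partial F/\partial t$ and $F_s=\partial F/\partial s$. (d) There exist constants $\beta_i>p_i$, $i=1,2$, such that $$0<F(x,t,s)\le\frac1{\beta_1}tF_t(x,t,s)+\frac1{\beta_2}sF_s(x,t,s)$$ for all $x\in V$ and $|(t,s)|\le\delta$ with $(t,s)\ne(0,0)$. Let $(u_0,v_0)\in W^{m_1,p_1}(V)\times W^{m_2,p_2}(V)$ satisfy $0<\|u_0\|_\infty\le\frac{\delta}{2}$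 and $0<\|v_0\|_\infty\le\frac{\delta}{2}$. Put $\theta_i=\min\{\beta_i,k_i\}$ $(i=1,2)$, $M_5=\frac1{k_1}(M_3+M_4)$, $M_6=\left(\frac{k_1-1}{k_1}+\frac1{k_2}\right)M_4$, $h_{i,\infty}=\min_{x\in V}h_i(x)$, $h_i^\infty=\max_{x\in V}h_i(x)$ $(i=1,2)$, $\mu_\infty=\min_{x\in V}\mu(x)$, and $$\Lambda_1=\frac{2^{1-\max\{p_1,p_2\}}}{\max\{p_1,p_2\}}\left(\frac{M_5}{\mu_\infty^{\frac{k_1-p_1}{p_1}}h_{1,\infty}^{\frac{k_1}{p_1}}}+\frac{M_6}{\mu_\infty^{\frac{k_2-p_2}{p_2}}h_{2,\infty}^{\frac{k_2}{p_2}}}\right)^{-1},$$ $$\Lambda_2=\frac{2^{1-\max\{p_1,p_2\}}}{\max\{p_1,p_2\}}\left(\frac{M_5}{\mu_\infty^{\frac{k_1-p_1}{p_1}}h_{1,\infty}^{\frac{k_1}{p_1}}}+\frac{M_6}{\mu_\infty^{\frac{k_2-p_2}{p_2}}h_{2,\infty}^{\frac{k_2}{p_2}}}\right)^{-1}\left(6h_{1,\infty}^{\frac1{p_1}}\|u_0\|_{L^{p_1}(V)}\right)^{\max\{p_1,p_2\}-\min\{k_1,k_2\}},$$ $$\Lambda_3=\frac{2^{1-\max\{p_1,p_2\}}}{\max\{p_1,p_2\}}\left(\frac{M_5}{\mu_\infty^{\frac{k_1-p_1}{p_1}}h_{1,\infty}^{\frac{k_1}{p_1}}}+\frac{M_6}{\mu_\infty^{\frac{k_2-p_2}{p_2}}h_{2,\infty}^{\frac{k_2}{p_2}}}\right)^{-1}\left(3h_{2,\infty}^{\frac1{p_2}}\|v_0\|_{L^{p_2}(V)}\right)^{\max\{p_1,p_2\}-\min\{k_1,k_2\}},$$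 $$\Lambda_4=\frac{\frac1{p_1}\max\{1,h_1^\infty\}\left(\|\nabla^{m_1}u_0\|_{L^{p_1}(V)}^{p_1}+\|u_0\|_{L^{p_1}(V)}^{p_1}\right)+\frac1{p_2}\max\{1,h_2^\infty\}\left(\|\nabla^{m_2}v_0\|_{L^{p_2}(V)}^{p_2}+\|v_0\|_{L^{p_2}(V)}^{p_2}\right)}{M_1\|u_0\|_{L^{p_1}(V)}^{q_1}\left(\sum_{x\in V}\mu(x)\right)^{1-\frac{q_1}{p_1}}+M_2\|v_0\|_{L^{p_2}(V)}^{q_2}\left(\sum_{x\in V}\mu(x)\right)^{1-\frac{q_2}{p_2}}},$$ $$C_{1,*}=\frac{(q_1-p_1)\sum_{x\in V}\mu(x)}{p_1}\left(\frac{(\max\{1,h_1^\infty\})^{q_1}}{q_1^{q_1}M_1^{p_1}}\right)^{\frac1{q_1-p_1}}\left(\frac{\left(\|\nabla^{m_1}u_0\|_{L^{p_1}(V)}^{p_1}+\|u_0\|_{L^{p_1}(V)}^{p_1}\right)^{\frac1{p_1}}}{\|u_0\|_{L^{p_1}(V)}}\right)^{\frac{p_1q_1}{q_1-p_1}},$$ $$C_{2,*}=\frac{(q_2-p_2)\sum_{x\in V}\mu(x)}{p_2}\left(\frac{(\max\{1,h_2^\infty\})^{q_2}}{q_2^{q_2}M_2^{p_2}}\right)^{\frac1{q_2-p_2}}\left(\frac{\left(\|\nabla^{m_2}v_0\|_{L^{p_2}(V)}^{p_2}+\|v_0\|_{L^{p_2}(V)}^{p_2}\right)^{\frac1{p_2}}}{\|v_0\|_{L^{p_2}(V)}}\right)^{\frac{p_2q_2}{q_2-p_2}},$$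 $$\Lambda_5=\max_{i\in\{1,2\}}\left(\frac{2^{2p_i+1}p_i\theta_i\max\{C_{1,*},C_{2,*}\}}{\delta^{p_i}(\theta_i-p_i)\mu_\infty h_{i,\infty}-2^{2p_i+1}p_i\theta_i\max\{C_{1,*},C_{2,*}\}}\right)^{\frac{1}{\max\left\{\frac{p_1}{q_1-p_1},\frac{p_2}{q_2-p_2}\right\}}}.$$ Then for all $\lambda>\lambda_*:=\max\{\Lambda_1,\Lambda_2,\Lambda_3,\Lambda_4,\Lambda_5\}$ there exists at least one nontrivial weak solution $(u_\lambda,v_\lambda)\ne(0,0)$ of the system $$\begin{cases}\pounds_{m_1,p_1}u+h_1(x)|u|^{p_1-2}u=\lambda F_u(x,u,v),& x\in V,\\ \pounds_{m_2,p_2}v+h_2(x)|v|^{p_2-2}v=\lambda F_v(x,u,v),& x\in V,\end{cases}$$ and $$\lim_{\lambda\to\infty}\|(u_\lambda,v_\lambda)\|=0=\lim_{\lambda\to\infty}\|(u_\lambda,v_\lambda)\|_\infty .$$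
   Context: Graph setting. $G=(V,E)$ is a finite graph ($V$ and $E$ finite), with edge weights $\omega:E\to(0,\infty)$, $\omega_{xy}=\omega_{yx}$, and a measure $\mu:V\to(0,\infty)$; $x\sim y$ means $\{x,y\}\in E$. $C(V)$ is the set of all functions $V\to\mathbb{R}$ and $\int_V\varphi\,d\mu=\sum_{x\in V}\mu(x)\varphi(x)$. Define $$\Delta\varphi(x)=\frac1{\mu(x)}\sum_{y\sim x}\omega_{xy}(\varphi(y)-\varphi(x)),\quad \Gamma(\varphi,\phi)(x)=\frac1{2\mu(x)}\sum_{y\sim x}\omega_{xy}(\varphi(y)-\varphi(x))(\phi(y)-\phi(x)),$$ $|\nabla\varphi|=\sqrt{\Gamma(\varphi,\varphi)}$. For an integer $m\ge1$, $|\nabla^m\varphi|=|\Delta^{m/2}\varphi|$ if $m$ is even and $|\nabla^m\varphi|=|\nabla\Delta^{(m-1)/2}\varphi|$ if $m$ is odd; $\|\nabla^m\varphi\|_{L^p(V)}^p=\int_V|\nabla^m\varphi|^p\,d\mu$. The poly-Laplacian $\pounds_{m,p}:C(V)\to C(V)$ ($p>1$) is defined by: for all $\phi\in C(V)$, $$\int_V(\pounds_{m,p}\varphi)\phi\,d\mu=\begin{cases}\int_V|\nabla^m\varphi|^{p-2}\,\Gamma(\Delta^{\frac{m-1}2}\varphi,\Delta^{\frac{m-1}2}\phi)\,d\mu,& m\text{ odd},\\ \int_V|\nabla^m\varphi|^{p-2}\,\Delta^{\frac m2}\varphi\,\Delta^{\frac m2}\phi\,d\mu,& m\text{ even},\end{cases}$$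 with the integrand read as $0$ where $|\nabla^m\varphi|=0$; likewise $|u|^{p-2}u=0$ where $u=0$. Norms. $\|\varphi\|_{L^q(V)}=(\int_V|\varphi|^q\,d\mu)^{1/q}$ and $\|\varphi\|_\infty=\max_{x\in V}|\varphi(x)|$. $W^{m_i,p_i}(V)$ is the space $C(V)$ with norm $\|\varphi\|_{m_i,p_i}=\left(\int_V(|\nabla^{m_i}\varphi|^{p_i}+h_i|\varphi|^{p_i})\,d\mu\right)^{1/p_i}$, $i=1,2$. For pairs, $\|(u,v)\|=\|u\|_{m_1,p_1}+\|v\|_{m_2,p_2}$ and $\|(u,v)\|_\infty=\max_{x\in V}|(u(x),v(x))|$, where $|(t,s)|=\sqrt{t^2+s^2}$. Here $F_u(x,u,v)$, $F_v(x,u,v)$ denote $F_t$, $F_s$ evaluated at $(x,u(x),v(x))$. A weak solution is a pair $(u,v)\in W^{m_1,p_1}(V)\times W^{m_2,p_2}(V)$ such that (the partial derivatives of $F$ existing at the values involved) for all $(\tilde u,\tilde v)\in W^{m_1,p_1}(V)\times W^{m_2,p_2}(V)$, $$\int_V\left(\pounds_{m_1,p_1}u\,\tilde u+h_1|u|^{p_1-2}u\tilde u\right)d\mu+\int_V\left(\pounds_{m_2,p_2}v\,\tilde v+h_2|v|^{p_2-2}v\tilde v\right)d\mu=\lambda\int_V F_u(x,u,v)\tilde u\,d\mu+\lambda\int_V F_v(x,u,v)\tilde v\,d\mu.$$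
   Formalization: The formal theorem assumes that both denominators in Λ_5, δ^{p_i}(θ_i−p_i)μ_∞h_{i,∞} − 2^{2p_i+1}p_iθ_i max{C_{1,*},C_{2,*}} (i=1,2), are positive; otherwise Λ_5, a real power of the quotient, and hence λ_* is undefined. *)

(* Defs.v *)
From HB Require Import structures.
From mathcomp Require Import all_boot all_order all_algebra.
From mathcomp Require Import all_classical all_reals all_analysis.
From mathcomp Require Import ring.

Set Implicit Arguments.
Unset Strict Implicit.
Unset Printing Implicit Defensive.

Import Order.TTheory GRing.Theory Num.Theory.
Import numFieldNormedType.Exports.
Local Open Scope classical_set_scope.
Local Open Scope ring_scope.

(* [weight x y] is only meaningful when [edge x y] holds.  Loops are not
   excluded; they contribute nothing to the operators below. *)
Record wgraph (R : realType) := WGraph {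
  vertex :> finType;
  edge : rel vertex;
  edge_sym : forall x y, edge x y = edge y x;
  weight : vertex -> vertex -> R;
  weight_gt0 : forall x y, edge x y -> 0 < weight x y;
  weight_sym : forall x y, edge x y -> weight x y = weight y x;
  mu : vertex -> R;
  mu_gt0 : forall x, 0 < mu x
}.

Section Calculus.
Context {R : realType} (G : wgraph R).
Implicit Types (phi psi : G -> R) (m : nat) (p : R).

Definition intV phi : R := \sum_(x : G) mu x * phi x.

Definition volV : R := \sum_(x : G) mu x.

(* Minimum and maximum over the vertices (0 if there are none). *)
Definition minV phi : R :=
  if [pick x : G] is Some x0 then \big[Num.min/phi x0]_(x : G) phi x else 0.

Definition maxV phi : R :=
  if [pick x : G] is Some x0 then \big[Num.max/phi x0]_(x : G) phi x else 0.

Definition lap phi : G -> R := fun x =>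
  (mu x)^-1 * \sum_(y : G | edge x y) weight x y * (phi y - phi x).

Definition gradform phi psi : G -> R := fun x =>
  (2 * mu x)^-1 *
  \sum_(y : G | edge x y) weight x y * (phi y - phi x) * (psi y - psi x).

Definition grad phi : G -> R := fun x => Num.sqrt (gradform phi phi x).

(* For odd [m], [m./2] is (m - 1) / 2. *)
Definition gradm m phi : G -> R := fun x =>
  if odd m then grad (iter m./2 lap phi) x else `|iter m./2 lap phi x|.

(* Where [gradm m phi x = 0], the second factor of the integrand vanishes, so
   that the integrand is 0 whatever the value of [0 `^ (p - 2)]. *)
Definition polyform m p phi psi : R :=
  intV (fun x => gradm m phi x `^ (p - 2) *
    if odd m then gradform (iter m./2 lap phi) (iter m./2 lap psi) x
    else iter m./2 lap phi x * iter m./2 lap psi x).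

Definition is_polylap m p phi (w : G -> R) : Prop :=
  forall psi, intV (fun x => w x * psi x) = polyform m p phi psi.

(* The function determined by [is_polylap]; see [polylapP] and [polylap_uniq]
   for existence and uniqueness. *)
Definition polylap m p phi : G -> R :=
  xget (fun=> 0) [set w | is_polylap m p phi w].

Definition lpnorm p phi : R := intV (fun x => `|phi x| `^ p) `^ p^-1.

Definition supnorm phi : R := maxV (fun x => `|phi x|).

Definition sobnorm m p (h : G -> R) phi : R :=
  intV (fun x => gradm m phi x `^ p + h x * `|phi x| `^ p) `^ p^-1.

Definition enorm (t s : R) : R := Num.sqrt (t ^+ 2 + s ^+ 2).

Definition pair_supnorm (u v : G -> R) : R := maxV (fun x => enorm (u x) (v x)).

Definition dt (F : G -> R -> R -> R) (x : G) (t s : R) : R :=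
  derive1 (fun t' : R => F x t' s) t.

Definition ds (F : G -> R -> R -> R) (x : G) (t s : R) : R :=
  derive1 (fun s' : R => F x t s') s.

Definition has_partials (F : G -> R -> R -> R) (x : G) (t s : R) : Prop :=
  derivable (fun t' : R => F x t' s) t 1 /\
  derivable (fun s' : R => F x t s') s 1.

(* F x is continuously differentiable on the closed disc of radius delta: its
   partial derivatives exist at every point of the disc and are continuous
   there. *)
Definition C1_on_disc (F : G -> R -> R -> R) (delta : R) (x : G) : Prop :=
  let disc := [set z : R * R | enorm z.1 z.2 <= delta] in
  [/\ forall t s, enorm t s <= delta -> has_partials F x t s,
      {within disc, continuous (fun z : R * R => dt F x z.1 z.2)} &
      {within disc, continuous (fun z : R * R => ds F x z.1 z.2)}].

Definition weak_solution (m1 m2 : nat) (p1 p2 : R) (h1 h2 : G -> R)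
    (F : G -> R -> R -> R) (lambda : R) (u v : G -> R) : Prop :=
  (forall x, has_partials F x (u x) (v x)) /\
  forall u' v' : G -> R,
    intV (fun x => polylap m1 p1 u x * u' x +
                   h1 x * `|u x| `^ (p1 - 2) * u x * u' x) +
    intV (fun x => polylap m2 p2 v x * v' x +
                   h2 x * `|v x| `^ (p2 - 2) * v x * v' x) =
    lambda * intV (fun x => dt F x (u x) (v x) * u' x) +
    lambda * intV (fun x => ds F x (u x) (v x) * v' x).

Let indic (x : G) : G -> R := fun y => (y == x)%:R.

Let linfE (a : R) phi psi x : (a *: phi + psi) x = a * phi x + psi x.
Proof. by []. Qed.

Let scaleE (a : R) phi x : (a *: phi) x = a * phi x.
Proof. by []. Qed.

Lemma iter_lap_lin k a phi psi :
  iter k lap (a *: phi + psi) = a *: iter k lap phi + iter k lap psi.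
Proof.
elim: k => //= k ->; apply/funext => x.
rewrite linfE /lap mulrCA -mulrDr; congr (_ * _).
rewrite mulr_sumr -big_split; apply: eq_bigr => y _ /=.
rewrite !linfE.
by ring.
Qed.

Lemma polyform_lin m p phi a f g :
  polyform m p phi (a *: f + g) = a * polyform m p phi f + polyform m p phi g.
Proof.
rewrite /polyform /intV mulr_sumr -big_split; apply: eq_bigr => x _ /=.
rewrite iter_lap_lin; set A := iter _ _ phi; set B := iter _ _ f.
set C := iter _ _ g; case: ifP => _; last first.
  by rewrite linfE; ring.
suff -> : gradform A (a *: B + C) x = a * gradform A B x + gradform A C x.
  by ring.
rewrite /gradform mulrCA -mulrDr; congr (_ * _).
rewrite mulr_sumr -big_split; apply: eq_bigr => y _ /=.
rewrite !linfE.
by ring.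
Qed.

Lemma is_polylap_ex m p phi : exists w, is_polylap m p phi w.
Proof.
exists (fun x => (mu x)^-1 * polyform m p phi (indic x)) => psi.
have lin0 : polyform m p phi 0 = 0.
  have := polyform_lin m p phi 1 0 0.
  by rewrite scaler0 addr0 mul1r => /esym/eqP; rewrite addrC -subr_eq0 addrK => /eqP.
have -> : psi = \sum_(x : G) psi x *: indic x.
  apply/funext => y; rewrite fct_sumE (bigD1 y) //= big1 => [|z /negPf zy].
    by rewrite addr0 scaleE /indic eqxx mulr1.
  by rewrite scaleE /indic eq_sym zy mulr0.
have sumE (r : seq G) : polyform m p phi (\sum_(x <- r) psi x *: indic x) =
    \sum_(x <- r) psi x * polyform m p phi (indic x).
  by elim: r => [|x r IH]; rewrite ?big_nil // !big_cons polyform_lin IH.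
rewrite sumE /intV; apply: eq_bigr => x _.
rewrite fct_sumE (bigD1 x) //= big1 => [|z /negPf zx]; last first.
  by rewrite scaleE /indic eq_sym zx mulr0.
rewrite scaleE /indic eqxx mulr1 addr0 mulrA.
by rewrite mulVKf ?gt_eqF ?mu_gt0 // mulrC.
Qed.

Lemma polylapP m p phi : is_polylap m p phi (polylap m p phi).
Proof. exact: (xgetPex (fun=> 0) (is_polylap_ex m p phi)). Qed.

Lemma polylap_uniq m p phi w : is_polylap m p phi w -> w = polylap m p phi.
Proof.
move=> hw; apply/funext => x.
have := hw (indic x); rewrite -(polylapP m p phi (indic x)) /intV.
have E (f : G -> R) : \sum_(y : G) mu y * (f y * indic x y) = mu x * f x.
  rewrite (bigD1 x) //= big1 => [|y /negPf yx]; rewrite /indic ?eqxx ?yx.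
    by rewrite mulr1 addr0.
  by rewrite !mulr0.
by rewrite !E => /(mulfI _); apply; rewrite gt_eqF // mu_gt0.
Qed.

End Calculus.

(* Main.v *)
(* Since G is finite, the system is the Euler-Lagrange equation of
   [J (u, v) = Phi_1 u + Phi_2 v - lambda * \int F(x, u, v)] on a
   finite-dimensional space, where [Phi_i] is the convex p_i-energy.  By (c) and
   (d), [F] is bounded near 0 by a multiple of [|t|^k1 + |s|^k2], so [J] is
   positive on small spheres; by (b) and [lambda > Lambda4] it is nonpositive at
   [(u0, v0)], and on the segment from 0 to [(u0, v0)] it stays below
   [c = C1 lambda^-(p1/(q1-p1)) + C2 lambda^-(p2/(q2-p2))].

   [F] is not extended outside the disc.  By (d), [J] at level at most [2 c]
   strictly decreases along the outward field [(u / beta1, v / beta2)] on the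
   shell [delta / 2 <= |(u, v)| <= 3 delta / 5], because [lambda > Lambda5]
   makes [2 c] smaller than the energies there.  A mountain pass argument in
   which sets may freely exit through this shell yields a critical point of [J]
   inside, at a level in [(0, 2 c]].  Testing the equation with
   [(u / beta1, v / beta2)] bounds its energies by a multiple of [c], which
   tends to 0 as [lambda] tends to infinity. *)
Require Import Defs.
From mathcomp Require Import all_boot all_order all_algebra.
From mathcomp Require Import all_classical all_reals all_analysis.
From mathcomp Require Import ring lra.
Import Order.TTheory GRing.Theory Num.Theory.
Import numFieldNormedType.Exports.
Local Open Scope classical_set_scope.
Local Open Scope ring_scope.

Set Implicit Arguments.
Unset Strict Implicit.
Unset Printing Implicit Defensive.

(** * A mountain pass theorem *)

(** The energies are never differentiated: for [p < 2] the weight |grad^m u|^(p-2) is singular. All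
    that is used of [J] is the upper estimate J(w') - J(w) <= L(w' - w) + e |w' - w|, locally
    uniform in both points. For the energies it follows from convexity and the continuity of the
    subgradient, for [F] from the mean value theorem, and it suffices for descent by a small
    explicit step.

    Pairs carry the maximum norm over vertices and components, while the hypotheses on [F] hold on a
    Euclidean disc. Three radii reconcile the two: delta / 2 bounds the pair (u0, v0), 3 delta / 5
    bounds the region searched for a critical point, and 2 delta / 3 < delta / sqrt 2 keeps all
    values in the disc while leaving room around that region for the local estimates.

    The factor 2 in [2 c] is strict slack: the mountain pass value is at most [c > 0], so almost
    optimal sets stay below [2 c], where the shell condition is available. *)

Definition dotrV {R : realType} {n} (a b : 'rV[R]_n) : R :=
  \sum_(i < n) a 0 i * b 0 i.

Lemma continuous_dotrV {R : realType} {n} (T : topologicalType)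
    (f g : T -> 'rV[R]_n) :
  continuous f -> continuous g -> continuous (fun x => dotrV (f x) (g x)).
Proof.
move=> cf cg x; apply: cvg_big => [|i _]; first exact: add_continuous.
by apply: cvgM; apply: (cvg_comp _ (fun w : 'rV[R]_n => w 0 i));
  [exact: cf|exact: coord_continuous|exact: cg|exact: coord_continuous].
Qed.

Lemma dotrVDr {R : realType} {n} (a b c : 'rV[R]_n) :
  dotrV a (b + c) = dotrV a b + dotrV a c.
Proof.
by rewrite /dotrV -big_split; apply: eq_bigr => i _; rewrite mxE mulrDr.
Qed.

Lemma dotrVZr {R : realType} {n} (k : R) (a b : 'rV[R]_n) :
  dotrV a (k *: b) = k * dotrV a b.
Proof.
by rewrite /dotrV mulr_sumr; apply: eq_bigr => i _; rewrite mxE mulrCA.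
Qed.

Lemma dotrV_gt0 {R : realType} {n} (a : 'rV[R]_n) : a != 0 -> 0 < dotrV a a.
Proof.
move=> a0; rewrite lt_neqAle sumr_ge0 ?andbT => [|i _]; last exact: sqr_ge0.
apply: contraNN a0 => /eqP/esym/psumr_eq0P a0; apply/eqP/rowP => i; rewrite mxE.
apply/eqP; rewrite -[_ == 0]orbb -mulf_eq0; apply/eqP/a0 => // j _.
exact: sqr_ge0.
Qed.

(** The norm maps a connected set onto an interval. This is the linking property: every competing
    set meets the sphere on which [J] is bounded below. *)
Lemma connected_norm_hits {R : realType} {n} (K : set 'rV[R]_n) e (rho : R) :
  connected K -> K 0 -> K e -> 0 <= rho <= `|e| ->
  exists2 w, K w & `|w| = rho.
Proof.
move=> cK K0 Ke /andP[rho0 rhoe].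
have /connected_intervalP itvK : connected ((fun w => `|w|) @` K).
  apply: connected_continuous_connected => //.
  by apply: continuous_subspaceT; exact: (@norm_continuous _ 'rV[R]_n).
have [|||w Kw <-] := itvK 0 `|e| _ _ rho; last by exists w.
- by exists 0 => //; rewrite normr0.
- by exists e.
- by rewrite rho0.
Qed.

(** Heine-Borel, which takes the place of a Palais-Smale condition. *)
Lemma closed_ball_compact {R : realType} {n} (r : R) (C : set 'rV[R]_n) :
  closed C -> compact ([set w : 'rV[R]_n | `|w| <= r] `&` C).
Proof.
move=> clC; apply: bounded_closed_compact.
  exists r; split; first exact: num_real.
  by move=> M rM w [/= wr _]; exact: (le_trans wr (ltW rM)).
apply: closedI => //.
rewrite (_ : mkset _ = (fun w : 'rV[R]_n => `|w|) @^-1` [set x | x <= r]) //.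
by apply: closed_comp => [? _|]; [exact: norm_continuous|exact: closed_le].
Qed.

Lemma segment_connected {R : realType} {n} (e : 'rV[R]_n) :
  connected ((fun t : R => t *: e) @` `[0, 1]).
Proof.
apply: connected_continuous_connected.
  by apply/connected_intervalP/interval_is_interval.
by apply: continuous_subspaceT => t; exact: cvgZr_tmp.
Qed.

(* [J] only matters on the ball of radius [r1]: competing connected sets may
   leave it, at no cost.  Since [J] decreases along the outward field [rad] near
   the boundary, deforming along [rad] there and along [- gJ] inside moves no
   point back into the ball.  In finite dimension a single small explicit step
   [w + s *: V w] replaces the gradient flow. *)
Lemma local_mountain_pass {R : realType} {n} (J : 'rV[R]_n -> R)
    (gJ rad : 'rV[R]_n -> 'rV[R]_n) (e : 'rV[R]_n) (r0 r1 rho alpha B B' : R) :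
  continuous J -> continuous gJ -> continuous rad -> gJ 0 = 0 ->
  J e <= 0 -> 0 < rho <= `|e| -> `|e| <= r0 -> r0 < r1 -> 0 < alpha ->
  (forall w, `|w| = rho -> alpha <= J w) ->
  (forall t, 0 <= t <= 1 -> J (t *: e) <= B) -> B < B' ->
  (forall w s, 0 <= s -> `|w| <= `|w + s *: rad w|) ->
  (forall w, r0 <= `|w| <= r1 -> J w <= B' -> dotrV (gJ w) (rad w) < 0) ->
  (forall w0 V0, `|w0| <= r1 -> dotrV (gJ w0) V0 < 0 ->
    \forall z \near (w0, V0) & s \near 0^'+, J (z.1 + s *: z.2) < J z.1) ->
  exists w, [/\ `|w| <= r1, gJ w = 0 & 0 < J w <= B'].
Proof.
move=> cJ cgJ crad gJ0 Je /andP[rho0 rhoe] er0 r01 alpha0 Jrho Jray BB'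
  rad_out rad_desc Jdesc.
apply: contrapT => nocrit.
have r0_gt0 : 0 < r0 by exact: lt_le_trans rho0 (le_trans rhoe er0).
(* The weight [a] of the gradient part is positive exactly inside the open ball of radius [r1], the
   weight [b] of the radial part exactly outside the closed ball of radius [r0]. The factor
   [|w - e|] in [V] keeps [e] fixed. *)
pose a (w : 'rV[R]_n) := Num.max 0 (r1 - `|w|).
pose b (w : 'rV[R]_n) := Num.max 0 (`|w| - r0).
pose V w := `|w - e| *: (a w *: - gJ w + b w *: rad w).
have a_ge0 w : 0 <= a w by rewrite le_max lexx.
have b_ge0 w : 0 <= b w by rewrite le_max lexx.
have ca : continuous a.
  move=> w; apply: (@continuous_max _ _ (fun=> 0) (fun w => r1 - `|w|)).
    exact: cst_continuous.
  by apply: continuousB; [exact: cst_continuous|exact: norm_continuous].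
have cb : continuous b.
  move=> w; apply: (@continuous_max _ _ (fun=> 0) (fun w => `|w| - r0)).
    exact: cst_continuous.
  by apply: continuousB; [exact: norm_continuous|exact: cst_continuous].
have cn : continuous (fun w : 'rV[R]_n => `|w - e|).
  by move=> w; exact: (cvg_norm (cvgB cvg_id (cvg_cst e))).
have cd : continuous (fun w : 'rV[R]_n => a w *: - gJ w + b w *: rad w).
  move=> w.
  exact: (cvgD (cvgZ (ca w) (cvgN (cgJ w))) (cvgZ (cb w) (crad w))).
have cV : continuous V by move=> w; exact: (cvgZ (cn w) (cd w)).
(* Both ends [0] and [e] must be fixed by the deformation, so that it maps competing sets to
   competing sets. *)
have V0 : V 0 = 0.
  have -> : V 0 = `|0 - e| *: (a 0 *: - gJ 0 + b 0 *: rad 0) by [].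
  have -> : b 0 = 0 by rewrite /b normr0 sub0r max_l // oppr_le0 ltW.
  by rewrite gJ0 oppr0 scaler0 scale0r addr0 scaler0.
have Ve : V e = 0 by rewrite /V subrr normr0 scale0r.
(* Outside the ball only the radial part is left, so a point that has left the ball cannot re-enter
   it. *)
have Vout w s : r1 < `|w| -> 0 <= s -> r1 < `|w + s *: V w|.
  move=> r1w s0; suff : `|w| <= `|w + s *: V w| by exact: lt_le_trans.
  rewrite /V /a max_l ?subr_le0 ?(ltW r1w) // scale0r add0r !scalerA.
  by apply: rad_out; rewrite !mulr_ge0.
(* For [r0 < |w|] the radial term is strictly negative and the gradient term nonpositive; for
   [|w| <= r0] only the gradient term remains, with positive weight. *)
have Vdesc w : `|w| <= r1 -> alpha / 2 <= J w <= B' ->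
    dotrV (gJ w) (V w) < 0.
  move=> wr1 /andP[Jw JwB].
  have Jw0 : 0 < J w by apply: lt_le_trans Jw; rewrite divr_gt0.
  have gJw : gJ w != 0.
    by apply/eqP => gw; apply: nocrit; exists w; split => //; apply/andP.
  have we : 0 < `|w - e|.
    rewrite normr_gt0 subr_eq0; apply/eqP => we.
    by move: Jw0; rewrite we ltNge Je.
  rewrite /V dotrVZr pmulr_rlt0 // dotrVDr !dotrVZr -scaleN1r dotrVZr.
  rewrite mulN1r mulrN addrC subr_lt0.
  have [r0w|wr0] := ltP r0 `|w|.
    apply: (@lt_le_trans _ _ 0).
      rewrite pmulr_rlt0; first by apply: rad_desc => //; rewrite (ltW r0w).
      by rewrite lt_max subr_gt0 r0w orbT.
    by rewrite mulr_ge0 // ltW // dotrV_gt0.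
  rewrite /b max_l ?subr_le0 // mul0r mulr_gt0 ?dotrV_gt0 //.
  by rewrite lt_max subr_gt0 (le_lt_trans wr0) ?orbT.
(* The band of levels on which a uniform decrease is needed. It reaches down to [alpha / 2] only:
   below it, a small increase is harmless. *)
pose K := [set w : 'rV[R]_n | `|w| <= r1] `&`
  (J @^-1` [set x | alpha / 2 <= x <= B']).
have cK : compact K.
  apply: closed_ball_compact; apply: closed_comp => [? _|]; first exact: cJ.
  rewrite (_ : mkset _ = [set` `[alpha / 2, B']]); first exact: itv_closed.
  by apply/funext => x /=; rewrite in_itv.
pose C := [set w : 'rV[R]_n | `|w| <= r1] `&` setT.
have cC : compact C by apply: closed_ball_compact; exact: closedT.
have /compact_near_coveringP/(_ R 0^'+) covK := cK.
have /compact_near_coveringP/(_ R 0^'+) covC := cC.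
have nK : \forall s \near 0^'+, K `<=` (fun w => J (w + s *: V w) < J w).
  apply: covK => w [wr1 Jw].
  have [[P Q] /= [nP nQ] sub] := Jdesc w (V w) wr1 (Vdesc w wr1 Jw).
  exists ((fun w' => P (w', V w')), Q) => /=; last first.
    by move=> [w' s] /= [Pw Qs]; exact: (sub ((w', V w'), s) (conj Pw Qs)).
  split=> //; apply: (cvg_pair cvg_id (cV w)); exact: nP.
(* A rise of less than [alpha / 4] takes a level under [alpha / 2] to one under [3 / 4 * alpha],
   still below the minimax value. *)
have nC : \forall s \near 0^'+, C `<=`
    (fun w => J (w + s *: V w) < J w + alpha / 4).
  apply: covC => w _.
  have cz : continuous (fun z : 'rV[R]_n * R => z.1 + z.2 *: V z.1).
    move=> z; have cV1 : {for z, continuous (fun z : 'rV[R]_n * R => V z.1)}.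
      by apply: continuous_comp; [exact: cvg_fst|exact: cV].
    exact: (cvgD cvg_fst (cvgZ cvg_snd cV1)).
  have cg : continuous
      (fun z : 'rV[R]_n * R => J (z.1 + z.2 *: V z.1) - J z.1).
    move=> z; have cJ1 : {for z, continuous (fun z : 'rV[R]_n * R => J z.1)}.
      by apply: continuous_comp; [exact: cvg_fst|exact: cJ].
    exact: (cvgB (continuous_comp (cz z) (cJ _)) cJ1).
  have : \forall z \near (w, 0 : R), J (z.1 + z.2 *: V z.1) - J z.1 < alpha / 4.
    by apply: (cvgr_lt _ (cg _)); rewrite /= scale0r addr0 subrr divr_gt0.
  move=> [[P Q] /= [nP nQ] sub]; exists (P, Q).
    by split=> //=; apply: cvg_within.
  by move=> [w' s] /= [Pw Qs]; have := sub (w', s) (conj Pw Qs) => /=; lra.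
have [s [[s0 sK] sC]] :=
  filter_ex (filterI (filterI (nbhs_right_gt (0 : R)) nK) nC).
pose eta w := w + s *: V w.
have ceta : continuous eta.
  by move=> w; exact: (cvgD cvg_id (cvgZ (cvg_cst s) (cV w))).
(* The strict decrease attains a positive minimum on the compact band; if the band is empty, any
   positive [nu] will do. *)
have [nu nu0 Jnu] : exists2 nu, 0 < nu & forall w, K w -> J (eta w) + nu <= J w.
  have [K0|/set0P nK0] := eqVneq K set0.
    by exists 1 => // w; rewrite K0.
  have [|w Kw wmin] := compact_EVT_min nK0 cK (f := fun w => J w - J (eta w)).
    apply: continuous_subspaceT => w.
    exact: (cvgB (cJ w) (continuous_comp (ceta w) (cJ _))).
  exists (J w - J (eta w)).
    by rewrite subr_gt0; apply: sK; exact: set_mem.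
  by move=> v /mem_set /wmin; lra.
pose A := [set a | exists L : set 'rV[R]_n, [/\ connected L, L 0, L e &
  forall w, L w -> `|w| <= r1 -> J w <= a]].
have AB : A B.
  exists ((fun t => t *: e) @` `[0, 1]); split.
  - exact: segment_connected.
  - by exists 0; rewrite ?scale0r //= in_itv /= lexx ler01.
  - by exists 1; rewrite ?scale1r //= in_itv /= lexx ler01.
  - by move=> _ [t + <-] _; rewrite /= in_itv /=; exact: Jray.
have lbA : lbound A alpha.
  move=> x [L [cL L0 Le LJ]].
  have [|w Lw wrho] := @connected_norm_hits _ _ L e rho cL L0 Le.
    by rewrite (ltW rho0).
  apply: (le_trans (Jrho w wrho)); apply: LJ => //.
  by rewrite wrho (le_trans rhoe) // (le_trans er0) // ltW.
have infA : has_inf A by split; [exists B|exists alpha].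
pose c := inf A.
have ac : alpha <= c by apply: lb_le_inf; [exists B|].
have cB : c <= B by apply: ge_inf => //; exists alpha.
(* The chosen set must be within [nu / 2] of the minimax value, for the gain [nu] to pass below it,
   and under [B'], for its points at levels above [alpha / 2] to lie in the band. *)
have [||x [L [cL L0 Le LJ]] xlt] := @inf_adherent _ A (Num.min (B' - c) (nu / 2)) => //.
  by rewrite lt_min subr_gt0 (le_lt_trans cB BB') divr_gt0.
have {xlt} [xB xnu] : x <= B' /\ x <= c + nu / 2.
  have m1 : Num.min (B' - c) (nu / 2) <= B' - c by rewrite ge_min lexx.
  have m2 : Num.min (B' - c) (nu / 2) <= nu / 2 by rewrite ge_min lexx orbT.
  by move: xlt; rewrite -/c; split; lra.
(* Both entries of this maximum are smaller than [c], the second because [0 < alpha <= c]; this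
   contradicts the choice of [c] as an infimum. *)
suff : A (Num.max (c - nu / 2) (3 / 4 * alpha)).
  move=> /(ge_inf infA.2); rewrite -/c le_max => /orP[]; lra.
exists (eta @` L); split.
- by apply: connected_continuous_connected => //; exact: continuous_subspaceT.
- by exists 0 => //; rewrite /eta V0 scaler0 addr0.
- by exists e => //; rewrite /eta Ve scaler0 addr0.
move=> _ [w Lw <-] etaw; rewrite le_max.
have wr1 : `|w| <= r1.
  by rewrite leNgt; apply/negP => /Vout/(_ (ltW s0)); rewrite ltNge etaw.
have [aw|wa] := leP (alpha / 2) (J w).
  have /Jnu : K w by split=> //=; rewrite aw (le_trans (LJ w Lw wr1)).
  by have := LJ w Lw wr1; move=> *; apply/orP; left; lra.
have : J (eta w) < J w + alpha / 4 by apply: sC; split.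
by move=> *; apply/orP; right; lra.
Qed.

(** * Powers *)

Section PowerInequalities.
Context {R : realType}.

Lemma continuous_norm_powR (p : R) : 0 < p -> continuous (fun x : R => `|x| `^ p).
Proof.
move=> p0 x; have [->|x0] := eqVneq x 0.
  apply/cvgrPdist_lt => e e0; near=> y.
  rewrite normr0 powR0 ?gt_eqF // sub0r normrN ger0_norm ?powR_ge0 //.
  rewrite -[ltRHS]powRr1 ?ltW // -(mulVf (lt0r_neq0 p0)) powRrM.
  apply: gt0_ltr_powR; rewrite ?nnegrE ?powR_ge0 //.
  near: y; apply: (cvgr_lt (`|0 : R|)); first exact: norm_continuous.
  by rewrite normr0 powR_gt0.
apply: (@continuous_comp _ _ _ (fun x : R => `|x|) (fun y => y `^ p)).
  exact: norm_continuous.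
apply/differentiable_continuous/derivable1_diffP/derivable_powR.
by rewrite in_itv /= normr_gt0 x0.
Unshelve. all: by end_near. Qed.

Lemma continuous_powR_comp (T : topologicalType) (f : T -> R) (p : R) :
  0 < p -> (forall t, 0 <= f t) -> continuous f -> continuous (fun t => f t `^ p).
Proof.
move=> p0 f0 cf; rewrite (_ : (fun t => _) = (fun t => `|f t| `^ p)).
  move=> t; apply: (@continuous_comp _ _ _ f (fun y => `|y| `^ p)).
    exact: cf.
  exact: continuous_norm_powR.
by apply/funext => t; rewrite ger0_norm.
Qed.

(* Where [f] vanishes, the product is dominated by [C * f `^ (p - 1)], which
   tends to 0 since [1 < p]. *)
Lemma continuous_powRM (T : topologicalType) (f g : T -> R) (p C : R) :
  1 < p -> (forall t, 0 <= f t) -> continuous f -> continuous g ->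
  (forall t, `|g t| <= C * f t) -> continuous (fun t => f t `^ (p - 2) * g t).
Proof.
move=> p1 f0 cf cg gC t; have [ft0|ft_gt0] := eqVneq (f t) 0.
  have gt0 : g t = 0.
    by apply/eqP; rewrite -normr_le0; have := gC t; rewrite ft0 mulr0.
  rewrite /continuous_at gt0 mulr0.
  have lim0 : (fun s => C * f s `^ (p - 1)) @ t --> (0 : R).
    have := @continuous_powR_comp T f (p - 1); rewrite subr_gt0 => /(_ p1 f0 cf t).
    rewrite /continuous_at ft0 powR0 ?gt_eqF ?subr_gt0 // => /(cvgM (cvg_cst C)).
    by rewrite mulr0.
  apply: (squeeze_cvgr _ (f := fun s => - (C * f s `^ (p - 1))) _ lim0); last first.
    by rewrite -oppr0; exact: cvgN.
  near=> s; rewrite -ler_norml normrM (ger0_norm (powR_ge0 _ _)).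
  have [fs0|fs_gt0] := eqVneq (f s) 0.
    have -> : g s = 0.
      by apply/eqP; rewrite -normr_le0; have := gC s; rewrite fs0 mulr0.
    by rewrite normr0 mulr0 fs0 powR0 ?mulr0 // gt_eqF ?subr_gt0.
  apply: le_trans (ler_wpM2l (powR_ge0 _ _) (gC s)) _.
  rewrite (_ : p - 1 = (p - 2) + 1); last by ring.
  by rewrite (@powRD _ _ (p - 2) 1) ?fs_gt0 ?implybT // powRr1 // mulrCA.
have ft_pos : 0 < f t by rewrite lt_neqAle eq_sym ft_gt0 f0.
apply: cvgM (cg t).
apply: (@continuous_comp _ _ _ f (fun y => y `^ (p - 2))); first exact: cf.
apply/differentiable_continuous/derivable1_diffP/derivable_powR.
by rewrite in_itv /= ft_pos.
Unshelve. all: by end_near. Qed.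

(* Young's inequality [p a b^(p-1) <= a^p + (p - 1) b^p] *)
Lemma powR_tangent (p a b : R) : 1 < p -> 0 <= a -> 0 <= b ->
  (a `^ p - b `^ p) / p <= a `^ (p - 1) * (a - b).
Proof.
move=> p1 a0 b0; have p0 : 0 < p by exact: lt_trans p1.
have p10 : 0 < p - 1 by rewrite subr_gt0.
have := @conjugate_powR _ (a `^ (p - 1)) b (p / (p - 1)) p (powR_ge0 _ _) b0.
rewrite divr_gt0 // => /(_ isT p0) H.
have {H} : a `^ (p - 1) * b <=
    (a `^ (p - 1)) `^ (p / (p - 1)) / (p / (p - 1)) + b `^ p / p.
  by apply: H; field; rewrite !gt_eqF.
rewrite -powRrM (_ : (p - 1) * (p / (p - 1)) = p); last by field; rewrite gt_eqF.
rewrite (_ : a `^ p / (p / (p - 1)) = a `^ p - a `^ p / p); last first.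
  by field; rewrite !gt_eqF.
rewrite mulrBr mulrBl (mulrC _ a) mulr_powRB1 //; lra.
Qed.

(* The hypothesis on [c] is what Cauchy-Schwarz gives for the inner product
   of vectors of norms [a] and [b]. *)
Lemma powR_tangent_CS (p a b c : R) : 1 < p -> 0 <= a -> 0 <= b ->
  c <= a * b -> (a `^ p - b `^ p) / p <= a `^ (p - 2) * (a ^+ 2 - c).
Proof.
move=> p1 a0 b0 cab; apply: (le_trans (powR_tangent p1 a0 b0)).
have [a0E|a1] := eqVneq a 0.
  move: cab; rewrite a0E mul0r => c0.
  rewrite powR0 ?gt_eqF ?subr_gt0 // mul0r mulr_ge0 ?powR_ge0 //.
  by rewrite expr0n /= sub0r oppr_ge0.
rewrite (_ : p - 1 = (p - 2) + 1); last by ring.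
rewrite (@powRD _ _ (p - 2) 1) ?a1 ?implybT // powRr1 // -mulrA ler_wpM2l ?powR_ge0 //.
by rewrite mulrBr -expr2 lerD2l lerN2.
Qed.

(** Discriminant argument: the quadratic [A + 2 * t * s + t ^+ 2 * B] is a weighted sum of squares,
    and its minimiser [- s / B] gives the inequality. *)
Lemma sum_CauchySchwarz (I : finType) (P : pred I) (c f g : I -> R) :
  (forall i, P i -> 0 <= c i) ->
  `|\sum_(i | P i) c i * f i * g i| <=
    Num.sqrt (\sum_(i | P i) c i * f i ^+ 2) *
    Num.sqrt (\sum_(i | P i) c i * g i ^+ 2).
Proof.
move=> c0; set s := \sum_(i | P i) c i * f i * g i.
set A := \sum_(i | P i) _ * f i ^+ 2; set B := \sum_(i | P i) _ * g i ^+ 2.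
have A0 : 0 <= A by apply: sumr_ge0 => i Pi; rewrite mulr_ge0 ?sqr_ge0 ?c0.
have B0 : 0 <= B by apply: sumr_ge0 => i Pi; rewrite mulr_ge0 ?sqr_ge0 ?c0.
have Q t : 0 <= A + 2 * t * s + t ^+ 2 * B.
  rewrite (_ : _ + _ = \sum_(i | P i) c i * (f i + t * g i) ^+ 2); last first.
    rewrite /A /s /B !mulr_sumr -!big_split /=.
    by apply: eq_bigr => i _; ring.
  by apply: sumr_ge0 => i Pi; rewrite mulr_ge0 ?sqr_ge0 ?c0.
suff sAB : s ^+ 2 <= A * B.
  by rewrite -sqrtrM // -sqrtr_sqr ler_wsqrtr.
have [B_gt0|] := ltP 0 B; last first.
  move=> Ble; have {Ble} BE : B = 0 by apply/eqP; rewrite eq_le Ble.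
  have [->|s0] := eqVneq s 0; first by rewrite expr0n /= mulr_ge0.
  (* With [B = 0] the quadratic is affine in [t], and this [t] would give it the value -1. *)
  have := Q (- (A + 1) / (2 * s)); rewrite BE.
  rewrite (_ : A + _ + _ = -1); last by field.
  by rewrite lerNr oppr0 ler10.
have := Q (- s / B).
rewrite (_ : A + _ + _ = (A * B - s ^+ 2) / B); last by field; rewrite gt_eqF.
by rewrite pmulr_lge0 ?invr_gt0 // subr_ge0.
Qed.

End PowerInequalities.

Lemma continuous_mul {R : realType} (T : topologicalType) (f g : T -> R) :
  continuous f -> continuous g -> continuous (fun t => f t * g t).
Proof. by move=> cf cg t; exact: (cvgM (cf t) (cg t)). Qed.

Lemma continuous_sub {R : realType} (T : topologicalType) (f g : T -> R) :
  continuous f -> continuous g -> continuous (fun t => f t - g t).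
Proof. by move=> cf cg t; exact: (cvgB (cf t) (cg t)). Qed.

Lemma continuous_add {R : realType} (T : topologicalType) (f g : T -> R) :
  continuous f -> continuous g -> continuous (fun t => f t + g t).
Proof. by move=> cf cg t; exact: (cvgD (cf t) (cg t)). Qed.

Lemma continuous_compR {R : realType} (T : topologicalType) (f : T -> R)
    (g : R -> R) :
  continuous f -> continuous g -> continuous (fun t => g (f t)).
Proof.
by move=> cf cg t; apply: continuous_comp; [exact: cf|exact: cg].
Qed.

Lemma continuous_sum {R : realType} (T : topologicalType) (I : finType)
    (P : pred I) (F : I -> T -> R) :
  (forall i, continuous (F i)) -> continuous (fun t => \sum_(i | P i) F i t).
Proof.
by move=> cF t; apply: cvg_big => [|i _]; [exact: add_continuous|exact: cF].
Qed.

(** * Bilinear forms and continuity of the graph operators *)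

Section GraphOperators.
Context {R : realType} (G : wgraph R).
Implicit Types (u v psi h : G -> R) (m : nat) (p : R).

Definition delta_at (x : G) : G -> R := fun y => (y == x)%:R.

(** The bilinear form polarising |grad^m u|^2. It treats both parities of [m] at once, so that the
    estimates below need no case distinction. *)
Definition polypair m u v : G -> R := fun x =>
  if odd m then gradform (iter m./2 (@lap R G) u) (iter m./2 (@lap R G) v) x
  else iter m./2 (@lap R G) u x * iter m./2 (@lap R G) v x.

Lemma gradm_ge0 m u x : 0 <= gradm m u x.
Proof. by rewrite /gradm; case: odd; rewrite ?sqrtr_ge0. Qed.

Lemma gradform_ge0 u x : 0 <= gradform u u x.
Proof.
rewrite mulr_ge0 ?invr_ge0 ?mulr_ge0 ?(ltW (mu_gt0 _)) //.
by apply: sumr_ge0 => y /weight_gt0/ltW w0; rewrite -mulrA mulr_ge0 // sqr_ge0.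
Qed.

Lemma polypair_diag m u x : polypair m u u x = gradm m u x ^+ 2.
Proof.
rewrite /polypair /gradm; case: odd; last by rewrite -normrX ger0_norm // sqr_ge0.
by rewrite sqr_sqrtr // gradform_ge0.
Qed.

Lemma polypair_CS m u v x : `|polypair m u v x| <= gradm m u x * gradm m v x.
Proof.
rewrite /polypair /gradm; case: odd; last by rewrite normrM.
have c0 : 0 <= (2 * mu x)^-1 by rewrite invr_ge0 mulr_ge0 ?(ltW (mu_gt0 _)).
rewrite /grad /gradform normrM (ger0_norm c0) !sqrtrM // mulrACA -expr2 sqr_sqrtr //.
apply: ler_wpM2l => //.
set f := fun y => iter m./2 (@lap R G) u y - iter m./2 (@lap R G) u x.
set g := fun y => iter m./2 (@lap R G) v y - iter m./2 (@lap R G) v x.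
have := @sum_CauchySchwarz R G (fun y => edge x y) (fun y => weight x y) f g.
move=> /(_ (fun y xy => ltW (weight_gt0 xy))); congr (_ <= _ * _); congr Num.sqrt;
  by apply: eq_bigr => y _; rewrite expr2 mulrA.
Qed.

Lemma gradm_scale m u a x : gradm m (a *: u) x = `|a| * gradm m u x.
Proof.
have lapZ k : iter k (@lap R G) (a *: u) = a *: iter k (@lap R G) u.
  have := iter_lap_lin k a u (0 : G -> R); rewrite addr0 => ->.
  (* Linearity with scalar -1 at the zero function shows that the iterated Laplacian sends 0 to
     0. *)
  have := iter_lap_lin k (-1) (0 : G -> R) 0.
  by rewrite scaler0 addr0 scaleN1r addNr => ->; rewrite addr0.
have ZE (phi : G -> R) y : (a *: phi) y = a * phi y by [].
rewrite /gradm lapZ; case: odd; last by rewrite ZE normrM.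
rewrite /grad -sqrtr_sqr -sqrtrM ?sqr_ge0 //; congr Num.sqrt.
rewrite /gradform mulrCA; congr (_ * _); rewrite mulr_sumr.
by apply: eq_bigr => y _; rewrite !ZE; ring.
Qed.

Section Families.
Variables (T : topologicalType) (f : T -> G -> R).
Hypothesis cf : forall x, continuous (f ^~ x).

Lemma continuous_lap k x : continuous (fun t => iter k (@lap R G) (f t) x).
Proof.
elim: k x => [|k IH] x //=.
rewrite /lap; apply: continuous_mul; first exact: cst_continuous.
apply: continuous_sum => y t.
exact: (cvgM (cvg_cst _) (cvgB (IH y t) (IH x t))).
Qed.

Lemma continuous_gradm m x : continuous (fun t => gradm m (f t) x).
Proof.
rewrite /gradm; case: odd; last first.
  apply: (@continuous_compR _ _ _ (fun y : R => `|y|)).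
    exact: continuous_lap.
  exact: norm_continuous.
apply: (@continuous_compR _ _ (fun t => gradform _ _ _) Num.sqrt); last first.
  exact: sqrt_continuous.
apply: continuous_mul; first exact: cst_continuous.
apply: continuous_sum => y.
have c1 : continuous (fun t =>
    iter m./2 (@lap R G) (f t) y - iter m./2 (@lap R G) (f t) x).
  by apply: continuous_sub; exact: continuous_lap.
by do 2!apply: continuous_mul => //; exact: cst_continuous.
Qed.

Lemma continuous_polypair m v x : continuous (fun t => polypair m (f t) v x).
Proof.
rewrite /polypair; case: odd; last first.
  apply: continuous_mul; [exact: continuous_lap|exact: cst_continuous].
apply: continuous_mul; first exact: cst_continuous.
apply: continuous_sum => y.
apply: continuous_mul; last exact: cst_continuous.
apply: continuous_mul; first exact: cst_continuous.
by apply: continuous_sub; exact: continuous_lap.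
Qed.

Lemma continuous_intV (g : T -> G -> R) :
  (forall x, continuous (g ^~ x)) -> continuous (fun t => intV (g t)).
Proof.
move=> cg; apply: continuous_sum => x; apply: continuous_mul => //.
exact: cst_continuous.
Qed.

End Families.
End GraphOperators.

(** * The energy of a function *)

Section EnergyFunctional.
Context {R : realType} (G : wgraph R) (m : nat) (p : R) (h : G -> R).
Hypotheses (p1 : 1 < p) (h0 : forall x, 0 < h x).
Implicit Types u v : G -> R.

Let p0 : 0 < p. Proof. exact: lt_trans p1. Qed.

Definition energy u : R :=
  p^-1 * intV (fun x => gradm m u x `^ p + h x * `|u x| `^ p).

(** The factor [mu x] makes this the gradient for the plain sum over vertices, so that pairing it
    with [v] gives the weak form directly. *)
Definition energy_grad u : G -> R := fun x =>
  mu x * (polylap m p u x + h x * `|u x| `^ (p - 2) * u x).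

Lemma energy_grad_pair u v :
  \sum_x energy_grad u x * v x =
  intV (fun x => polylap m p u x * v x + h x * `|u x| `^ (p - 2) * u x * v x).
Proof. by apply: eq_bigr => x _; rewrite /energy_grad; ring. Qed.

Lemma energy_grad_pairE u v :
  \sum_x energy_grad u x * v x =
  intV (fun x => gradm m u x `^ (p - 2) * polypair m u v x +
                 h x * (`|u x| `^ (p - 2) * (u x * v x))).
Proof.
have -> : intV (fun x => gradm m u x `^ (p - 2) * polypair m u v x +
    h x * (`|u x| `^ (p - 2) * (u x * v x))) = polyform m p u v +
    intV (fun x => h x * (`|u x| `^ (p - 2) * (u x * v x))).
  by rewrite /polyform /intV -big_split; apply: eq_bigr => x _; rewrite mulrDr.
rewrite -polylapP /intV -big_split; apply: eq_bigr => x _.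
by rewrite /energy_grad /=; ring.
Qed.

Lemma powR_sub2_sqr (a : R) : 0 <= a -> a `^ (p - 2) * a ^+ 2 = a `^ p.
Proof.
move=> a0; have [->|an0] := eqVneq a 0.
  by rewrite expr0n /= mulr0 powR0 // gt_eqF.
by rewrite -powR_mulrn // -powRD ?an0 ?implybT // subrK.
Qed.

(** Euler's identity for a functional homogeneous of degree [p]; it turns testing the equation with
    the solution itself into an energy bound. *)
Lemma energy_euler u : \sum_x energy_grad u x * u x = p * energy u.
Proof.
rewrite energy_grad_pairE /energy mulVKf ?gt_eqF //.
congr intV; apply/funext => x.
rewrite polypair_diag powR_sub2_sqr ?gradm_ge0 //; congr (_ + _ * _).
by rewrite -expr2 -(@real_normK _ (u x)) ?num_real // powR_sub2_sqr.
Qed.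

(** The subgradient inequality, summed from pointwise tangent inequalities for the power:
    Cauchy-Schwarz for [polypair] handles the gradient term, and |v u| = |v| |u| the potential
    term. *)
Lemma energy_convex u v :
  energy v - energy u <= \sum_x energy_grad v x * (v x - u x).
Proof.
have -> : \sum_x energy_grad v x * (v x - u x) =
    \sum_x energy_grad v x * v x - \sum_x energy_grad v x * u x.
  by rewrite -sumrB; apply: eq_bigr => x _; rewrite mulrBr.
rewrite !energy_grad_pairE /energy /intV !mulr_sumr -!sumrB.
apply: ler_sum => x _; rewrite mulrCA [X in _ - X]mulrCA -!mulrBr.
rewrite ler_pM2l ?mu_gt0 // polypair_diag.
have pd := powR_tangent_CS p1 (gradm_ge0 m v x) (gradm_ge0 m u x)
  (le_trans (ler_norm _) (polypair_CS m v u x)).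
have := powR_tangent_CS p1 (normr_ge0 (v x)) (normr_ge0 (u x))
  (le_trans (ler_norm (v x * u x)) _).
rewrite normrM lexx => /(_ isT); rewrite real_normK ?num_real //.
move=> hd; have := lerD pd (ler_wpM2l (ltW (h0 x)) hd).
by congr (_ <= _); ring.
Qed.

Lemma energyZ (t : R) u : 0 <= t -> energy (t *: u) = t `^ p * energy u.
Proof.
move=> t0; rewrite /energy mulrCA; congr (_ * _).
rewrite /intV mulr_sumr; apply: eq_bigr => x _.
have -> : (t *: u) x = t * u x by [].
rewrite gradm_scale normrM ger0_norm // !powRM ?gradm_ge0 //.
by ring.
Qed.

Lemma energy_ge_potential u :
  p^-1 * intV (fun x => h x * `|u x| `^ p) <= energy u.
Proof.
rewrite /energy ler_pM2l ?invr_gt0 //; apply: ler_sum => x _.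
by rewrite ler_pM2l ?mu_gt0 // lerDr powR_ge0.
Qed.

Section Families.
Variables (T : topologicalType) (f : T -> G -> R).
Hypothesis cf : forall x, continuous (f ^~ x).

Lemma continuous_energy : continuous (fun t => energy (f t)).
Proof.
apply: continuous_mul; first exact: cst_continuous.
apply: continuous_intV => x; apply: continuous_add.
  apply: continuous_powR_comp => // [t|]; first exact: gradm_ge0.
  exact: continuous_gradm.
apply: continuous_mul; first exact: cst_continuous.
by apply: (continuous_compR (g := fun y => `|y| `^ p)) => //; exact: continuous_norm_powR.
Qed.

(** [polylap] is obtained by choice. Pairing with the indicator of [x] replaces it by an explicit
    formula whose continuity can be checked; Cauchy-Schwarz supplies the linear bound that controls
    the singular weight when [p < 2]. *)
Lemma continuous_energy_grad x : continuous (fun t => energy_grad (f t) x).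
Proof.
have E u : energy_grad u x = \sum_y energy_grad u y * delta_at x y.
  rewrite (bigD1 x) //= /delta_at eqxx mulr1 big1 ?addr0 // => y /negPf ->.
  by rewrite mulr0.
rewrite (_ : (fun t => _) = fun t => \sum_y energy_grad (f t) y * delta_at x y);
  last by apply/funext => t; exact: E.
under eq_fun do rewrite energy_grad_pairE.
apply: continuous_intV => y; apply: continuous_add.
  apply: (@continuous_powRM _ _ _ _ _ (gradm m (delta_at x) y)) => //.
  - by move=> t; exact: gradm_ge0.
  - exact: continuous_gradm.
  - exact: continuous_polypair.
  - by move=> t; rewrite mulrC; exact: polypair_CS.
apply: continuous_mul; first exact: cst_continuous.
apply: (@continuous_powRM _ _ _ _ _ `|delta_at x y|) => //.
- by apply: (continuous_compR (g := fun y => `|y|)) => //; exact: norm_continuous.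
- by apply: continuous_mul => //; exact: cst_continuous.
- by move=> t; rewrite normrM mulrC.
Qed.

End Families.
End EnergyFunctional.

(** * The functional of the system *)

Section Rows.
Context {R : realType} (V : finType).
Local Notation X := 'rV[R]_#|{: V + V}|.
Implicit Types (w : X) (x : V) (u v : V -> R).

(** Pairs of functions are row vectors indexed by [V + V]: the norm of such a vector is the maximum
    over vertices and both components. *)
Definition row_fst w : V -> R := fun x => w 0 (enum_rank (inl x : V + V)).
Definition row_snd w : V -> R := fun x => w 0 (enum_rank (inr x : V + V)).
Definition row_pair u v : X :=
  \row_i match enum_val i with inl x => u x | inr x => v x end.

Lemma row_pairK1 u v : row_fst (row_pair u v) = u.
Proof. by apply/funext => x; rewrite /row_fst mxE enum_rankK. Qed.

Lemma row_pairK2 u v : row_snd (row_pair u v) = v.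
Proof. by apply/funext => x; rewrite /row_snd mxE enum_rankK. Qed.

Lemma row_fstZ a w : row_fst (a *: w) = a *: row_fst w.
Proof. by apply/funext => x; rewrite /row_fst mxE. Qed.

Lemma row_sndZ a w : row_snd (a *: w) = a *: row_snd w.
Proof. by apply/funext => x; rewrite /row_snd mxE. Qed.

Lemma row_fstB w1 w2 x : row_fst (w1 - w2) x = row_fst w1 x - row_fst w2 x.
Proof. by rewrite /row_fst !mxE. Qed.

Lemma row_sndB w1 w2 x : row_snd (w1 - w2) x = row_snd w1 x - row_snd w2 x.
Proof. by rewrite /row_snd !mxE. Qed.

Lemma continuous_row_fst x : continuous (row_fst ^~ x).
Proof. by move=> w; exact: coord_continuous. Qed.

Lemma continuous_row_snd x : continuous (row_snd ^~ x).
Proof. by move=> w; exact: coord_continuous. Qed.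

Lemma norm_rowP w (r : R) : 0 <= r ->
  reflect (forall x, `|row_fst w x| <= r /\ `|row_snd w x| <= r) (`|w| <= r).
Proof.
move=> r0; apply: (iffP idP) => [wr x|H].
  have le (i : 'I_#|{: V + V}|) : `|w 0 i| <= r.
    apply: le_trans wr; rewrite [leRHS]mx_normrE.
    exact: (le_bigmax _ (fun ij : 'I_1 * 'I__ => `|w ij.1 ij.2|) (0, i)).
  by split; exact: le.
rewrite [leLHS]mx_normrE; apply: bigmax_le => // -[i j] _ /=.
rewrite ord1 -(enum_valK j).
by case: (enum_val j) => x; have [] := H x.
Qed.

Lemma norm_row_fst w x : `|row_fst w x| <= `|w|.
Proof. by have /norm_rowP - /(_ (normr_ge0 _) x)[] := lexx `|w|. Qed.

Lemma norm_row_snd w x : `|row_snd w x| <= `|w|.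
Proof. by have /norm_rowP - /(_ (normr_ge0 _) x)[] := lexx `|w|. Qed.

Lemma norm_row_ge w (r : R) : 0 < r -> r <= `|w| ->
  exists x, r <= `|row_fst w x| \/ r <= `|row_snd w x|.
Proof.
move=> r0 rw; apply: contrapT => /forallNP H.
suff : `|w| < r by rewrite ltNge rw.
rewrite [ltLHS]mx_normrE; apply: bigmax_lt => // -[i j] _ /=.
rewrite ord1 -(enum_valK j) ltNge; apply/negP.
by case: (enum_val j) => x le; apply: (H x); [left|right].
Qed.

Lemma dotrV_row_pair u v w :
  dotrV (row_pair u v) w =
  \sum_x u x * row_fst w x + \sum_x v x * row_snd w x.
Proof.
have -> : dotrV (row_pair u v) w =
    \sum_(y : V + V) match y with inl x => u x * row_fst w x
                                | inr x => v x * row_snd w x end.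
  rewrite /dotrV (reindex (@enum_rank (V + V)%type)) /=; last first.
    by apply: onW_bij; exact: enum_rank_bij.
  by apply: eq_bigr => -[x|x] _; rewrite mxE enum_rankK.
by rewrite big_sumType.
Qed.

End Rows.

(** * One-sided strict differentiability *)

Section StrictSub.
Context {R : realType} (n : nat).
Local Notation X := 'rV[R]_n.
Implicit Types (J : X -> R) (L : X -> R) (w : X).

(* The upper half of strict differentiability of [J] at [w], with derivative
   [L]. *)
Definition strict_sub J L w := forall e, 0 < e ->
  \forall z \near (w, w), J z.2 - J z.1 <= L (z.2 - z.1) + e * `|z.2 - z.1|.

Lemma strict_subD J1 J2 L1 L2 w : strict_sub J1 L1 w -> strict_sub J2 L2 w ->
  strict_sub (fun y => J1 y + J2 y) (fun y => L1 y + L2 y) w.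
Proof.
move=> S1 S2 e e0; have e2 : 0 < e / 2 by rewrite divr_gt0.
near=> z.
have N1 : J1 z.2 - J1 z.1 <= L1 (z.2 - z.1) + e / 2 * `|z.2 - z.1| by near: z; exact: S1.
have N2 : J2 z.2 - J2 z.1 <= L2 (z.2 - z.1) + e / 2 * `|z.2 - z.1| by near: z; exact: S2.
lra.
Unshelve. all: by end_near. Qed.

Lemma strict_sub_sum (I : finType) (J L : I -> X -> R) w :
  (forall i, strict_sub (J i) (L i) w) ->
  strict_sub (fun y => \sum_i J i y) (fun y => \sum_i L i y) w.
Proof.
move=> S; rewrite /index_enum; elim: Finite.enum => [|i r IH].
  move=> e e0; near=> z; rewrite !big_nil subrr add0r.
  by rewrite mulr_ge0 // ltW.
move=> e e0; have H := strict_subD (S i) IH e0.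
near=> z; rewrite !big_cons; near: z; exact: H.
Unshelve. all: by end_near. Qed.

(** Base point and direction may both vary, because the strict estimate is uniform in its two
    points; compactness arguments can then choose a common step. *)
Lemma strict_sub_descent J (g : X -> X) (w v : X) : strict_sub J (dotrV (g w)) w ->
  dotrV (g w) v < 0 ->
  \forall z \near (w, v) & s \near 0^'+, J (z.1 + s *: z.2) < J z.1.
Proof.
move=> S gv; have v1 : 0 < `|v| + 1 by rewrite ltr_wpDl.
(* Chosen so that for directions near [v] the error is at most half of [- dotrV (g w) v], while the
   linear part stays below half of [dotrV (g w) v]. *)
pose e := - dotrV (g w) v / (2 * (`|v| + 1)).
have e0 : 0 < e by rewrite divr_gt0 ?oppr_gt0 // mulr_gt0.
have [[A B] /= [nA nB] AB] := S e e0.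
have c1 : continuous (fun z : X * X => z.1) by move=> z; exact: cvg_fst.
have c2 : continuous (fun z : X * X => z.2) by move=> z; exact: cvg_snd.
have c3 : continuous (fun q : (X * X) * R => q.1.1 + q.2 *: q.1.2).
  move=> q.
  have d1 : {for q, continuous (fun q : (X * X) * R => q.1.1)}.
    by apply: continuous_comp; [exact: cvg_fst|exact: c1].
  have d2 : {for q, continuous (fun q : (X * X) * R => q.1.2)}.
    by apply: continuous_comp; [exact: cvg_fst|exact: c2].
  exact: (cvgD d1 (cvgZ cvg_snd d2)).
have c4 : continuous (fun z : X * X => dotrV (g w) z.2).
  exact: (@continuous_dotrV _ _ _ (fun=> g w) _ (@cst_continuous _ _ (g w)) c2).
have n4 : \forall z \near (w, v), dotrV (g w) z.2 < dotrV (g w) v / 2.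
  by apply: (cvgr_lt _ (@c4 (w, v))) => /=; lra.
have n2 : \forall z \near (w, v), `|z.2| < `|v| + 1.
  by apply: (cvgr_lt _ (cvg_norm (@c2 (w, v)))) => /=; lra.
have nAz : \forall z \near (w, v), A z.1 by exact: (@c1 (w, v)).
have nBq : \forall q \near ((w, v), 0 : R), B (q.1.1 + q.2 *: q.1.2).
  by apply: (@c3 ((w, v), 0)); rewrite /= scale0r addr0.
case: nBq => -[P Q] /= [nP nQ] PQ.
exists (P `&` [set z | [/\ dotrV (g w) z.2 < dotrV (g w) v / 2,
    `|z.2| < `|v| + 1 & A z.1]], Q `&` [set s | 0 < s]).
  split => /=.
    by apply: filterI => //; near=> z; split; near: z.
  apply: filterI; first by apply: cvg_within.
  exact: nbhs_right_gt.
move=> q /= [[Pq [q4 q2 Aq]] [Qq q0]].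
have Bq : B (q.1.1 + q.2 *: q.1.2) by exact: PQ.
have := AB (q.1.1, q.1.1 + q.2 *: q.1.2) (conj Aq Bq) => /=.
rewrite addrAC subrr add0r dotrVZr normrZ gtr0_norm // => le.
rewrite -subr_lt0; apply: (le_lt_trans le).
rewrite mulrCA -mulrDr pmulr_rlt0 //.
have : e * `|q.1.2| <= e * (`|v| + 1) by rewrite ler_pM2l // ltW.
have -> : e * (`|v| + 1) = - dotrV (g w) v / 2 by rewrite /e; field; lra.
lra.
Unshelve. all: by end_near. Qed.

End StrictSub.

(** * The nonlinearity at a single vertex *)

Section VertexFunction.
Context {R : realType}.

(* Composing with [clamp] makes [F], which is only controlled near 0, globally
   continuous. *)
Definition clamp (r t : R) : R := Num.max (- r) (Num.min r t).

Lemma continuous_clamp r : continuous (clamp r).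
Proof.
move=> t; apply: (@continuous_max _ _ (fun=> - r)); first exact: cst_continuous.
by apply: (@continuous_min _ _ (fun=> r)); [exact: cst_continuous|exact: cvg_id].
Qed.

Lemma clamp_norm r t : 0 <= r -> `|clamp r t| <= r.
Proof.
move=> r0; rewrite ler_norml /clamp le_max lexx /= ge_max ge_min lexx /= andbT.
by rewrite (le_trans _ r0) // oppr_le0.
Qed.

Lemma clamp_id r t : `|t| <= r -> clamp r t = t.
Proof. by rewrite ler_norml => /andP[a b]; rewrite /clamp min_r // max_r. Qed.

Lemma MVT_unordered (f : R -> R) (a b : R) :
  (forall x, (a <= x <= b) || (b <= x <= a) -> derivable f x 1) ->
  exists2 c, (a <= c <= b) || (b <= c <= a) & f b - f a = derive1 f c * (b - a).
Proof.
wlog ab : a b / a <= b => [H|] df.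
  have [/H|/ltW ba] := leP a b; first exact.
  have [|c cab E] := H b a ba; first by move=> x; rewrite orbC; exact: df.
  by exists c; [rewrite orbC|rewrite -opprB E -mulrN opprB].
have [x|x|c cab E] := @MVT_segment _ f (derive1 f) a b ab.
- rewrite in_itv /= => /andP[ax xb].
  rewrite derive1E; apply: DeriveDef => //; apply: df.
  by rewrite (ltW ax) (ltW xb).
- apply: derivable_within_continuous => y; rewrite in_itv /= => yab.
  by apply: df; rewrite yab.
- by exists c => //; move: cab; rewrite in_itv /= => ->.
Qed.

Lemma between_dist_lt (a b c t d : R) : (a <= c <= b) || (b <= c <= a) ->
  `|a - t| < d -> `|b - t| < d -> `|c - t| < d.
Proof.
rewrite !ltr_norml => /orP[] /andP[? ?] /andP[? ?] /andP[? ?];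
  by apply/andP; split; lra.
Qed.

Lemma between_norm_le (a b c d : R) : (a <= c <= b) || (b <= c <= a) ->
  `|a| <= d -> `|b| <= d -> `|c| <= d.
Proof.
rewrite !ler_norml => /orP[] /andP[? ?] /andP[? ?] /andP[? ?];
  by apply/andP; split; lra.
Qed.

Lemma within_comp_continuous (T U V : topologicalType) (D : set U) (f : U -> V)
    (c : T -> U) :
  (forall t, D (c t)) -> continuous c -> {within D, continuous f} ->
  continuous (fun t => f (c t)).
Proof.
move=> cD cc /subspace_continuousP cf t.
apply: (cvg_comp c f _ (cf _ (cD t))) => P /= wP.
rewrite /= nbhs_filterE; near=> s.
suff : D (c s) -> P (c s) by apply.
by near: s; exact: (cc t _ wP).
Unshelve. all: by end_near.
Qed.

Variables (f : R -> R -> R) (r : R).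
Hypothesis r0 : 0 <= r.
Hypothesis dft : forall t s, `|t| <= r -> `|s| <= r -> derivable (f ^~ s) t 1.
Hypothesis dfs : forall t s, `|t| <= r -> `|s| <= r -> derivable (f t) s 1.
Let ft t s := derive1 (f ^~ s) t.
Let fs t s := derive1 (f t) s.
Hypothesis cft : continuous (fun z : R * R => ft (clamp r z.1) (clamp r z.2)).
Hypothesis cfs : continuous (fun z : R * R => fs (clamp r z.1) (clamp r z.2)).

(** Change one coordinate at a time, passing through the corner [(t1, s2)], with the mean value
    theorem on each leg. The corner and both legs stay in a square, whereas they could leave a
    disc. *)
Lemma C1_strict (t s e : R) : `|t| <= r -> `|s| <= r -> 0 < e ->
  exists2 d, 0 < d & forall t1 s1 t2 s2 : R,
    [/\ `|t1| <= r, `|s1| <= r, `|t2| <= r & `|s2| <= r] ->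
    [/\ `|t1 - t| < d, `|s1 - s| < d, `|t2 - t| < d & `|s2 - s| < d] ->
    `|f t2 s2 - f t1 s1 - (ft t s * (t2 - t1) + fs t s * (s2 - s1))| <=
      e * (`|t2 - t1| + `|s2 - s1|).
Proof.
move=> tr sr e0.
have /cvgrPdist_lt/(_ e e0)/nbhs_ballP[d1 /= d10 B1] := @cft (t, s).
have /cvgrPdist_lt/(_ e e0)/nbhs_ballP[d2 /= d20 B2] := @cfs (t, s).
exists (Num.min d1 d2); first by rewrite lt_min d10.
move=> t1 s1 t2 s2 [t1r s1r t2r s2r]; rewrite !lt_min.
move=> [/andP[t1d1 t1d2] /andP[s1d1 s1d2] /andP[t2d1 t2d2] /andP[s2d1 s2d2]].
have [c1 c1b E1] := @MVT_unordered (f ^~ s2) t1 t2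
  (fun x xb => dft (between_norm_le xb t1r t2r) s2r).
have [c2 c2b E2] := @MVT_unordered (f t1) s1 s2
  (fun x xb => dfs t1r (between_norm_le xb s1r s2r)).
have Bc1 : `|ft c1 s2 - ft t s| < e.
  have := B1 (c1, s2); rewrite /= !clamp_id ?(between_norm_le c1b) // distrC.
  apply; split; rewrite /ball /= distrC //; exact: (between_dist_lt c1b).
have Bc2 : `|fs t1 c2 - fs t s| < e.
  have := B2 (t1, c2); rewrite /= !clamp_id ?(between_norm_le c2b) // distrC.
  apply; split; rewrite /ball /= distrC //; exact: (between_dist_lt c2b).
rewrite (_ : _ - _ = (ft c1 s2 - ft t s) * (t2 - t1) +
                     (fs t1 c2 - fs t s) * (s2 - s1)); last first.
  rewrite /ft /fs -[f t2 s2](subrK (f t1 s2)) E1 -[f t1 s2](subrK (f t1 s1)) E2.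
  by ring.
move: (ft c1 s2 - ft t s) (fs t1 c2 - fs t s) Bc1 Bc2 => a b ae be.
rewrite [leRHS]mulrDr; apply: le_trans (ler_normD _ _) _; rewrite !normrM.
by apply: lerD; apply: ler_wpM2r => //; exact: ltW.
Qed.

Lemma C1_continuous : continuous (fun z : R * R => f (clamp r z.1) (clamp r z.2)).
Proof.
move=> z; apply/cvgrPdist_lt => eta eta0.
set t := clamp r z.1; set s := clamp r z.2.
(* The strict estimate with error 1 already gives a local Lipschitz bound, with constant [K]. *)
have [d d0 H] := @C1_strict t s 1 (clamp_norm _ r0) (clamp_norm _ r0) ltr01.
pose K := `|ft t s| + `|fs t s| + 1.
have K0 : 0 < K by rewrite ltr_wpDl // addr_ge0.
have dK : 0 < Num.min d (eta / (2 * K)).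
  by rewrite lt_min d0 divr_gt0 // mulr_gt0.
have c1 : continuous (fun y : R * R => clamp r y.1).
  move=> y; apply: (@continuous_comp _ _ _ (@fst R R)); first exact: cvg_fst.
  exact: continuous_clamp.
have c2 : continuous (fun y : R * R => clamp r y.2).
  move=> y; apply: (@continuous_comp _ _ _ (@snd R R)); first exact: cvg_snd.
  exact: continuous_clamp.
have n1 : \forall y \near z, `|t - clamp r y.1| < Num.min d (eta / (2 * K)).
  by move/cvgrPdist_lt : (c1 z) => /(_ _ dK).
have n2 : \forall y \near z, `|s - clamp r y.2| < Num.min d (eta / (2 * K)).
  by move/cvgrPdist_lt : (c2 z) => /(_ _ dK).
near=> y.
have : `|t - clamp r y.1| < Num.min d (eta / (2 * K)) by near: y.
have : `|s - clamp r y.2| < Num.min d (eta / (2 * K)) by near: y.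
rewrite !lt_min => /andP[s1 s2] /andP[t1 t2].
rewrite distrC in t1; rewrite distrC in t2; rewrite distrC in s1; rewrite distrC in s2.
have tt : `|t - t| < d by rewrite subrr normr0.
have ss : `|s - s| < d by rewrite subrr normr0.
have := H t s _ _ (And4 (clamp_norm _ r0) (clamp_norm _ r0)
  (clamp_norm y.1 r0) (clamp_norm y.2 r0)) (And4 tt ss t1 s1).
set a := clamp r y.1 - t; set b := clamp r y.2 - s; rewrite mul1r => le.
have le2 : `|f (clamp r y.1) (clamp r y.2) - f t s| <= K * (`|a| + `|b|).
  rewrite -[X in `|X|](subrK (ft t s * a + fs t s * b)).
  apply: le_trans (ler_normD _ _) _; apply: le_trans (lerD le (ler_normD _ _)) _.
  rewrite !normrM /K; have := normr_ge0 (ft t s); have := normr_ge0 (fs t s).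
  by have := normr_ge0 a; have := normr_ge0 b; nra.
rewrite distrC; apply: (le_lt_trans le2).
have E : K * (eta / (2 * K) + eta / (2 * K)) = eta by field; rewrite gt_eqF.
by rewrite -[ltRHS]E ltr_pM2l // ltrD.
Unshelve. all: by end_near. Qed.

End VertexFunction.

Lemma continuous_rowP {R : realType} n (T : topologicalType) (g : T -> 'rV[R]_n) :
  (forall i, continuous (fun t => g t 0 i)) -> continuous g.
Proof.
move=> cg; rewrite (_ : g = fun t => \sum_(i < n) g t 0 i *: delta_mx 0 i); last first.
  by apply/funext => t; exact: row_sum_delta.
move=> t; apply: cvg_big => [|i _]; first exact: add_continuous.
exact: (cvgZ (cg i t) (cvg_cst _)).
Qed.

Lemma near_diag (T : topologicalType) (w : T) (P : T -> Prop) :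
  (\forall y \near w, P y) -> \forall z \near (w, w), P z.1 /\ P z.2.
Proof. by move=> nP; exists (P, P). Qed.

Section SystemFunctional.
Context {R : realType} (G : wgraph R).
Local Notation X := 'rV[R]_#|{: G + G}|.
Implicit Types (w : X) (u v : G -> R).

(** Convexity bounds the increment by the gradient at the second point; continuity of the gradient
    replaces it by the one at [w] at the cost of [e]. The projection [pr] stands for either
    component of the pair. *)
Lemma energy_strict_sub m p (h : G -> R) (pr : X -> G -> R) w :
  1 < p -> (forall x, 0 < h x) ->
  (forall w1 w2 x, pr (w1 - w2) x = pr w1 x - pr w2 x) ->
  (forall w x, `|pr w x| <= `|w|) -> (forall x, continuous (pr ^~ x)) ->
  strict_sub (fun y => energy m p h (pr y))
             (fun y => \sum_x energy_grad m p h (pr w) x * pr y x) w.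
Proof.
move=> p1 h0 prB prn cpr e e0.
pose D z := \sum_x `|energy_grad m p h (pr z) x - energy_grad m p h (pr w) x|.
have cD : continuous D.
  apply: continuous_sum => x.
  apply: (continuous_compR (g := fun y => `|y|)); last exact: norm_continuous.
  apply: continuous_sub; last exact: cst_continuous.
  exact: continuous_energy_grad.
have Dw : D w = 0.
  by rewrite /D big1 // => x _; rewrite subrr normr0.
have nD : \forall z \near (w, w), D z.2 < e.
  have nw : \forall z \near w, D z < e by apply: (cvgr_lt _ (cD w)); rewrite Dw.
  exact: (@cvg_snd _ _ (nbhs w) (nbhs w) _ _ nw).
near=> z; apply: le_trans (energy_convex m p1 h0 (pr z.1) (pr z.2)) _.
have Dz : D z.2 < e by near: z.
have -> : \sum_x energy_grad m p h (pr z.2) x * (pr z.2 x - pr z.1 x) =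
    \sum_x energy_grad m p h (pr w) x * pr (z.2 - z.1) x +
    \sum_x (energy_grad m p h (pr z.2) x - energy_grad m p h (pr w) x) *
      pr (z.2 - z.1) x.
  by rewrite -big_split; apply: eq_bigr => x _; rewrite prB /=; ring.
rewrite lerD2l; apply: (@le_trans _ _ (D z.2 * `|z.2 - z.1|)).
  rewrite /D mulr_suml; apply: ler_sum => x _.
  by apply: le_trans (ler_norm _) _; rewrite normrM ler_wpM2l.
by rewrite ler_wpM2r // ltW.
Unshelve. all: by end_near. Qed.

Section VertexTerm.
Variables (F : G -> R -> R -> R) (r : R).
Hypothesis r0 : 0 <= r.
Hypothesis FP : forall x t s, `|t| <= r -> `|s| <= r -> has_partials F x t s.
Hypothesis cdt : forall x,
  continuous (fun z : R * R => dt F x (clamp r z.1) (clamp r z.2)).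
Hypothesis cds : forall x,
  continuous (fun z : R * R => ds F x (clamp r z.1) (clamp r z.2)).

Let at_vertex w x : R * R := (row_fst w x, row_snd w x).

Let continuous_at_vertex x : continuous (at_vertex ^~ x).
Proof.
move=> w.
exact: (cvg_pair (@continuous_row_fst R G x w) (@continuous_row_snd R G x w)).
Qed.

Lemma continuous_vertexF x :
  continuous (fun w => F x (clamp r (row_fst w x)) (clamp r (row_snd w x))).
Proof.
have := @C1_continuous _ (F x) r r0 (fun t s tr sr => (FP x tr sr).1)
  (fun t s tr sr => (FP x tr sr).2) (@cdt x) (@cds x).
by move=> c w; exact: (continuous_comp (@continuous_at_vertex x w) (c _)).
Qed.

Lemma continuous_vertex_dt x :
  continuous (fun w => dt F x (clamp r (row_fst w x)) (clamp r (row_snd w x))).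
Proof. by move=> w; exact: (continuous_comp (@continuous_at_vertex x w) (@cdt x _)). Qed.

Lemma continuous_vertex_ds x :
  continuous (fun w => ds F x (clamp r (row_fst w x)) (clamp r (row_snd w x))).
Proof. by move=> w; exact: (continuous_comp (@continuous_at_vertex x w) (@cds x _)). Qed.

Lemma vertex_strict_sub (k : R) x w : `|w| < r ->
  strict_sub
    (fun y => k * F x (clamp r (row_fst y x)) (clamp r (row_snd y x)))
    (fun y => k * (dt F x (row_fst w x) (row_snd w x) * row_fst y x +
                   ds F x (row_fst w x) (row_snd w x) * row_snd y x)) w.
Proof.
move=> wr e e0.
(* The 2 pays for the two coordinates, each bounded by the norm; adding 1 to [|k|] avoids a division
   by zero. *)
pose e' := e / (2 * (`|k| + 1)).
have k1 : 0 < `|k| + 1 by rewrite ltr_wpDl.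
have e'0 : 0 < e' by rewrite divr_gt0 // mulr_gt0.
have fst_r y : `|y| <= r -> `|row_fst y x| <= r.
  by apply: le_trans; exact: norm_row_fst.
have snd_r y : `|y| <= r -> `|row_snd y x| <= r.
  by apply: le_trans; exact: norm_row_snd.
have [d d0 H] := @C1_strict _ (F x) r (fun t s tr sr => (FP x tr sr).1)
  (fun t s tr sr => (FP x tr sr).2) (@cdt x) (@cds x) _ _ e'
  (fst_r _ (ltW wr)) (snd_r _ (ltW wr)) e'0.
have cn : continuous (fun y : X => `|y|) by exact: norm_continuous.
have near_r : \forall y \near w, `|y| < r by apply: (cvgr_lt _ (cn w)).
have near_d : \forall y \near w, `|y - w| < d.
  have cd : continuous (fun y : X => `|y - w|).
    by move=> y; exact: (cvg_norm (cvgB cvg_id (cvg_cst w))).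
  by apply: (cvgr_lt _ (cd w)); rewrite subrr normr0.
have near1 := near_diag (filterI near_r near_d).
near=> z.
have [[z1r z1d] [z2r z2d]] : (`|z.1| < r /\ `|z.1 - w| < d) /\
    (`|z.2| < r /\ `|z.2 - w| < d) by near: z; exact: near1.
have fst_d y : `|y - w| < d -> `|row_fst y x - row_fst w x| < d.
  by apply: le_lt_trans; rewrite -row_fstB norm_row_fst.
have snd_d y : `|y - w| < d -> `|row_snd y x - row_snd w x| < d.
  by apply: le_lt_trans; rewrite -row_sndB norm_row_snd.
rewrite !clamp_id ?(fst_r _ (ltW z1r)) ?(snd_r _ (ltW z1r))
  ?(fst_r _ (ltW z2r)) ?(snd_r _ (ltW z2r)) //.
have := H _ _ _ _ (And4 (fst_r _ (ltW z1r)) (snd_r _ (ltW z1r))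
  (fst_r _ (ltW z2r)) (snd_r _ (ltW z2r)))
  (And4 (fst_d _ z1d) (snd_d _ z1d) (fst_d _ z2d) (snd_d _ z2d)).
rewrite -/(dt F x _ _) -/(ds F x _ _) -!row_fstB -!row_sndB.
set f1 := F _ _ _; set f2 := F _ _ _; set L := dt F _ _ _ * _ + _ => le.
have {}le : `|f1 - f2 - L| <= e' * (2 * `|z.2 - z.1|).
  apply: le_trans le _; rewrite ler_pM2l // mulr_natl mulr2n.
  by apply: lerD; [exact: norm_row_fst|exact: norm_row_snd].
rewrite -mulrBr -lerBlDl -mulrBr; apply: le_trans (ler_norm _) _; rewrite normrM.
apply: le_trans (ler_wpM2l (normr_ge0 _) le) _.
rewrite (_ : `|k| * _ = (`|k| / (`|k| + 1)) * (e * `|z.2 - z.1|)); last first.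
  by rewrite /e'; field; rewrite gt_eqF.
apply: ler_piMl; first by rewrite mulr_ge0 // ltW.
by rewrite ler_pdivrMr // mul1r lerDl.
Unshelve. all: by end_near. Qed.

End VertexTerm.
End SystemFunctional.

Lemma energy_grad0 {R : realType} (G : wgraph R) m (p : R) (h : G -> R) x :
  energy_grad m p h (0 : G -> R) x = 0.
Proof.
have -> : energy_grad m p h (0 : G -> R) x =
    \sum_y energy_grad m p h (0 : G -> R) y * delta_at x y.
  rewrite (bigD1 x) //= /delta_at eqxx mulr1 big1 ?addr0 // => y /negPf ->.
  by rewrite mulr0.
rewrite energy_grad_pairE /intV big1 // => y _.
have -> : polypair m (0 : G -> R) (delta_at x) y = 0.
  apply/eqP; rewrite -normr_le0; apply: le_trans (polypair_CS _ _ _ _) _.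
  by rewrite -[0 : G -> R](scale0r (0 : G -> R)) gradm_scale normr0 !mul0r.
have -> : (0 : G -> R) y = 0 by [].
by rewrite mul0r !mulr0 addr0 mulr0.
Qed.

(** Holds because 2 (2/3)^2 = 8/9 <= 1. *)
Lemma enorm_le {R : realType} (t s d : R) :
  `|t| <= 2 / 3 * d -> `|s| <= 2 / 3 * d -> enorm t s <= d.
Proof.
move=> td sd; have d0 : 0 <= d by have := le_trans (normr_ge0 t) td; lra.
rewrite /enorm -[leRHS]ger0_norm // -sqrtr_sqr ler_wsqrtr //.
rewrite -(real_normK (num_real t)) -(real_normK (num_real s)).
have t0 := normr_ge0 t; have s0 := normr_ge0 s; nra.
Qed.

(** * The functional [J]: regularity and critical points *)

Section System.
Context {R : realType} (G : wgraph R) (m1 m2 : nat) (p1 p2 : R)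
  (h1 h2 : G -> R) (F : G -> R -> R -> R) (delta lambda : R).
Hypotheses (p1_gt1 : 1 < p1) (p2_gt1 : 1 < p2).
Hypotheses (h1_gt0 : forall x, 0 < h1 x) (h2_gt0 : forall x, 0 < h2 x).
Hypotheses (delta_gt0 : 0 < delta) (lambda_gt0 : 0 < lambda).
Hypothesis condA : forall x, C1_on_disc F delta x.
Local Notation X := 'rV[R]_#|{: G + G}|.
Implicit Types (w : X) (x : G) (u v : G -> R).

(* A square of this half-side lies in the disc of radius [delta]. *)
Let r := 2 / 3 * delta.

Let r0 : 0 <= r. Proof. by rewrite mulr_ge0 // ltW. Qed.

Definition system_functional w : R :=
  energy m1 p1 h1 (row_fst w) + energy m2 p2 h2 (row_snd w) +
  \sum_x - (lambda * mu x) *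
    F x (clamp r (row_fst w x)) (clamp r (row_snd w x)).

(** It acts as the gradient of [J] where the clamps are the identity; elsewhere only its continuity
    matters. *)
Definition system_grad w : X := row_pair
  (fun x => energy_grad m1 p1 h1 (row_fst w) x -
    lambda * mu x * dt F x (clamp r (row_fst w x)) (clamp r (row_snd w x)))
  (fun x => energy_grad m2 p2 h2 (row_snd w) x -
    lambda * mu x * ds F x (clamp r (row_fst w x)) (clamp r (row_snd w x))).

Let FP x t s : `|t| <= r -> `|s| <= r -> has_partials F x t s.
Proof. by have [H _ _] := condA x; move=> tr sr; apply: H; exact: enorm_le. Qed.

Let clamp_pair (z : R * R) : R * R := (clamp r z.1, clamp r z.2).

Let continuous_clamp_pair : continuous clamp_pair.
Proof.
move=> z; exact: (cvg_pair
  (continuous_comp cvg_fst (@continuous_clamp _ r _))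
  (continuous_comp cvg_snd (@continuous_clamp _ r _))).
Qed.

Let clamp_disc z : [set z : R * R | enorm z.1 z.2 <= delta] (clamp_pair z).
Proof. by apply: enorm_le; exact: clamp_norm. Qed.

Let cdt x : continuous (fun z : R * R => dt F x (clamp r z.1) (clamp r z.2)).
Proof.
have [_ c _] := condA x.
exact: (within_comp_continuous clamp_disc continuous_clamp_pair c).
Qed.

Let cds x : continuous (fun z : R * R => ds F x (clamp r z.1) (clamp r z.2)).
Proof.
have [_ _ c] := condA x.
exact: (within_comp_continuous clamp_disc continuous_clamp_pair c).
Qed.

Lemma continuous_system_functional : continuous system_functional.
Proof.
apply: continuous_add.
  by apply: continuous_add; apply: continuous_energy => // x;
    [exact: continuous_row_fst|exact: continuous_row_snd].
apply: continuous_sum => x; apply: continuous_mul; first exact: cst_continuous.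
exact: continuous_vertexF.
Qed.

Lemma continuous_system_grad : continuous system_grad.
Proof.
apply: continuous_rowP => i.
rewrite (_ : (fun t => _) = fun w => match enum_val i with
  | inl x => energy_grad m1 p1 h1 (row_fst w) x -
      lambda * mu x * dt F x (clamp r (row_fst w x)) (clamp r (row_snd w x))
  | inr x => energy_grad m2 p2 h2 (row_snd w) x -
      lambda * mu x * ds F x (clamp r (row_fst w x)) (clamp r (row_snd w x))
  end); last by apply/funext => w; rewrite mxE.
case: (enum_val i) => x; apply: continuous_sub.
- by apply: continuous_energy_grad => // y; exact: continuous_row_fst.
- apply: continuous_mul; first exact: cst_continuous.
  exact: continuous_vertex_dt.
- by apply: continuous_energy_grad => // y; exact: continuous_row_snd.
- apply: continuous_mul; first exact: cst_continuous.
  exact: continuous_vertex_ds.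
Qed.

Lemma row_fst_clamp w x : `|w| <= r -> clamp r (row_fst w x) = row_fst w x.
Proof. by move=> wr; rewrite clamp_id // (le_trans (norm_row_fst _ _)). Qed.

Lemma row_snd_clamp w x : `|w| <= r -> clamp r (row_snd w x) = row_snd w x.
Proof. by move=> wr; rewrite clamp_id // (le_trans (norm_row_snd _ _)). Qed.

Lemma system_gradE w y : `|w| <= r -> dotrV (system_grad w) y =
  \sum_x energy_grad m1 p1 h1 (row_fst w) x * row_fst y x +
  \sum_x energy_grad m2 p2 h2 (row_snd w) x * row_snd y x +
  \sum_x - (lambda * mu x) *
    (dt F x (row_fst w x) (row_snd w x) * row_fst y x +
     ds F x (row_fst w x) (row_snd w x) * row_snd y x).
Proof.
move=> wr; rewrite dotrV_row_pair -!big_split /=.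
by apply: eq_bigr => x _; rewrite row_fst_clamp // row_snd_clamp //; ring.
Qed.

Lemma system_strict_sub w : `|w| < r ->
  strict_sub system_functional (dotrV (system_grad w)) w.
Proof.
move=> wr.
rewrite (_ : dotrV _ = fun y =>
  \sum_x energy_grad m1 p1 h1 (row_fst w) x * row_fst y x +
  \sum_x energy_grad m2 p2 h2 (row_snd w) x * row_snd y x +
  \sum_x - (lambda * mu x) *
    (dt F x (row_fst w x) (row_snd w x) * row_fst y x +
     ds F x (row_fst w x) (row_snd w x) * row_snd y x)); last first.
  by apply/funext => y; rewrite system_gradE // ltW.
apply: strict_subD.
  apply: strict_subD; apply: energy_strict_sub => //.
  - exact: row_fstB.
  - exact: norm_row_fst.
  - exact: continuous_row_fst.
  - exact: row_sndB.
  - exact: norm_row_snd.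
  - exact: continuous_row_snd.
by apply: strict_sub_sum => x; exact: vertex_strict_sub.
Qed.

Lemma system_weak_solution w : `|w| <= r -> system_grad w = 0 ->
  weak_solution m1 m2 p1 p2 h1 h2 F lambda (row_fst w) (row_snd w).
Proof.
move=> wr gw; split=> [x|u v].
  apply: FP; [exact: le_trans (norm_row_fst _ _) wr|].
  exact: le_trans (norm_row_snd _ _) wr.
have := system_gradE (row_pair u v) wr; rewrite gw.
have -> : dotrV (0 : X) (row_pair u v) = 0.
  by rewrite /dotrV big1 // => i _; rewrite mxE mul0r.
rewrite !energy_grad_pair row_pairK1 row_pairK2 => /esym/eqP.
rewrite addr_eq0 => /eqP ->; rewrite -sumrN /intV !mulr_sumr -big_split /=.
by apply: eq_bigr => x _; ring.
Qed.

(** * Consequences of the growth conditions on [F] *)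

Section Growth.
Variables (k1 k2 M3 M4 beta1 beta2 : R).
Hypotheses (k1_gt : p1 < k1) (k2_gt : p2 < k2) (M3_gt0 : 0 < M3) (M4_gt0 : 0 < M4).
Hypothesis condCt : forall x t s, enorm t s <= delta ->
  `|dt F x t s| <=
    M3 * `|t| `^ (k1 - 1) + M4 * `|s| `^ (k2 * (k1 - 1) / k1).
Hypothesis condCs : forall x t s, enorm t s <= delta ->
  `|ds F x t s| <=
    M3 * `|t| `^ (k1 * (k2 - 1) / k2) + M4 * `|s| `^ (k2 - 1).
Hypotheses (beta1_gt : p1 < beta1) (beta2_gt : p2 < beta2).
Hypothesis condD : forall x t s, enorm t s <= delta -> (t, s) <> (0, 0) ->
  0 < F x t s /\
  F x t s <= beta1^-1 * (t * dt F x t s) + beta2^-1 * (s * ds F x t s).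

(** The exponents in (c) are positive, which forces both partial derivatives of [F] to vanish at the
    origin. The deformation needs this to keep 0 fixed. *)
Lemma system_grad0 : system_grad 0 = 0.
Proof.
have r_ge0 : `|0 : X| <= r by rewrite normr0.
have d0 : enorm 0 0 <= delta by apply: enorm_le; rewrite normr0.
have fst0 : row_fst (0 : X) = 0 by apply/funext => x; rewrite /row_fst mxE.
have snd0 : row_snd (0 : X) = 0 by apply/funext => x; rewrite /row_snd mxE.
have k1_gt1 : 1 < k1 by exact: lt_trans k1_gt.
have k2_gt1 : 1 < k2 by exact: lt_trans k2_gt.
have sub1 (a : R) : 1 < a -> a - 1 != 0 by move=> a1; rewrite gt_eqF ?subr_gt0.
have expo (a b : R) : 1 < a -> 1 < b -> a * (b - 1) / b != 0.
  by move=> a1 b1; rewrite gt_eqF // divr_gt0 ?mulr_gt0 //; lra.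
have dt0 x : dt F x 0 0 = 0.
  apply/eqP; rewrite -normr_le0; apply: le_trans (condCt x d0) _.
  by rewrite normr0 (powR0 (sub1 _ k1_gt1)) (powR0 (expo _ _ k2_gt1 k1_gt1)) !mulr0 addr0.
have ds0 x : ds F x 0 0 = 0.
  apply/eqP; rewrite -normr_le0; apply: le_trans (condCs x d0) _.
  by rewrite normr0 (powR0 (sub1 _ k2_gt1)) (powR0 (expo _ _ k1_gt1 k2_gt1)) !mulr0 addr0.
apply/rowP => i; rewrite !mxE; case: (enum_val i) => x;
  rewrite row_fst_clamp // row_snd_clamp // fst0 snd0 energy_grad0.
  by rewrite (_ : (0 : G -> R) x = 0) // dt0 mulr0 subrr.
by rewrite (_ : (0 : G -> R) x = 0) // ds0 mulr0 subrr.
Qed.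

Let k1_gt1 : 1 < k1. Proof. exact: lt_trans k1_gt. Qed.
Let k2_gt1 : 1 < k2. Proof. exact: lt_trans k2_gt. Qed.
Let k1_gt0 : 0 < k1. Proof. exact: lt_trans k1_gt1. Qed.
Let k2_gt0 : 0 < k2. Proof. exact: lt_trans k2_gt1. Qed.
Let beta1_gt1 : 1 < beta1. Proof. exact: lt_trans beta1_gt. Qed.
Let beta2_gt1 : 1 < beta2. Proof. exact: lt_trans beta2_gt. Qed.

Let young (a b k l : R) : 0 <= a -> 0 <= b -> 1 < k -> 1 < l ->
  a * b `^ (l * (k - 1) / k) <= a `^ k + b `^ l.
Proof.
move=> a0 b0 kk ll; have k0 : 0 < k by lra.
have k10 : 0 < k - 1 by lra.
have conj : k^-1 + (k / (k - 1))^-1 = 1 by field; rewrite !gt_eqF.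
have := conjugate_powR a0 (powR_ge0 b (l * (k - 1) / k)) k0 (divr_gt0 k0 k10) conj.
rewrite -powRrM (_ : l * (k - 1) / k * (k / (k - 1)) = l); last first.
  by field; rewrite !gt_eqF.
move/le_trans; apply; apply: lerD; apply: ler_piMr; rewrite ?powR_ge0 //.
  by rewrite invf_le1 // ltW.
by rewrite invf_le1 ?divr_gt0 // ler_pdivlMr // mul1r gerBl.
Qed.

(** Each of the two terms on the right of (d) is at most [(M3 + M4) * (|t|^k1 + |s|^k2)], because
    [beta1] and [beta2] exceed 1; hence the factor 2. *)
Let K := 2 * (M3 + M4).

Let K0 : 0 < K. Proof. by rewrite mulr_gt0 ?addr_gt0. Qed.

Lemma potential_le_neq0 x t s : enorm t s <= delta -> (t, s) <> (0, 0) ->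
  F x t s <= K * (`|t| `^ k1 + `|s| `^ k2).
Proof.
move=> ts_d ts0; have [_] := condD x ts_d ts0; move/le_trans; apply.
set A := `|t| `^ k1; set B := `|s| `^ k2.
have A0 : 0 <= A by exact: powR_ge0.
have B0 : 0 <= B by exact: powR_ge0.
have tle : t * dt F x t s <= (M3 + M4) * (A + B).
  apply: le_trans (ler_norm _) _; rewrite normrM.
  apply: le_trans (ler_wpM2l (normr_ge0 t) (condCt x ts_d)) _.
  have := young (normr_ge0 t) (normr_ge0 s) k1_gt1 k2_gt1.
  have := mulr_powRB1 (normr_ge0 t) k1_gt0; rewrite -/A -/B => E1 yl.
  have y2 := ler_wpM2l (ltW M4_gt0) yl; have y3 := mulr_ge0 (ltW M3_gt0) B0.
  rewrite mulrDr (mulrCA `|t| M3) E1 (mulrCA `|t| M4).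
  by move: y2; rewrite !mulrDr !mulrDl; lra.
have sle : s * ds F x t s <= (M3 + M4) * (A + B).
  apply: le_trans (ler_norm _) _; rewrite normrM.
  apply: le_trans (ler_wpM2l (normr_ge0 s) (condCs x ts_d)) _.
  have := young (normr_ge0 s) (normr_ge0 t) k2_gt1 k1_gt1.
  have := mulr_powRB1 (normr_ge0 s) k2_gt0; rewrite -/A -/B => E2 yl.
  have y2 := ler_wpM2l (ltW M3_gt0) yl; have y3 := mulr_ge0 (ltW M4_gt0) A0.
  rewrite mulrDr (mulrCA `|s| M3) (mulrCA `|s| M4) E2.
  by move: y2; rewrite !mulrDr !mulrDl; lra.
have MAB : 0 <= (M3 + M4) * (A + B) by rewrite mulr_ge0 ?addr_ge0 // ltW.
have bnd (b y : R) : 1 < b -> y <= (M3 + M4) * (A + B) ->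
    b^-1 * y <= (M3 + M4) * (A + B).
  move=> b1 yle; have b0 : 0 < b by lra.
  rewrite ler_pdivrMl //; apply: le_trans yle _.
  by rewrite ler_peMl // ltW.
by rewrite /K -mulrA mulr2n mulrDl mul1r lerD // bnd.
Qed.

(** Condition (d) leaves out the origin. A positive value there would persist along the axis [s = 0]
    by continuity, against the bound [K * |t|^k1], which tends to 0. *)
Lemma potential_le0 x : F x 0 0 <= 0.
Proof.
rewrite leNgt; apply/negP => F0.
have d0 : enorm 0 0 <= delta by apply: enorm_le; rewrite normr0 mulr_ge0 // ltW.
have [H _ _] := condA x; have [dF _] := H 0 0 d0.
have cF : {for 0, continuous (fun t => F x t 0)}.
  by apply/differentiable_continuous/derivable1_diffP.
have cK : continuous (fun t : R => K * `|t| `^ k1).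
  apply: continuous_mul; first exact: cst_continuous.
  exact: continuous_norm_powR.
have cg : {for 0, continuous (fun t : R => F x t 0 - K * `|t| `^ k1)}.
  by apply: (@continuousB _ _ _ (F x ^~ 0)); [exact: cF|exact: cK].
have pos : \forall t \near (0 : R), 0 < F x t 0 - K * `|t| `^ k1.
  by apply: (cvgr_gt _ cg); rewrite normr0 powR0 ?mulr0 ?subr0 // gt_eqF.
have r_gt0 : 0 < r by rewrite mulr_gt0.
have pos' : \forall t \near (0 : R)^'+, 0 < F x t 0 - K * `|t| `^ k1.
  by move: pos; apply: filterS.
near (0 : R)^'+ => t.
have Ft : 0 < F x t 0 - K * `|t| `^ k1 by near: t.
have t0 : 0 < t by near: t; exact: nbhs_right_gt.
have tr : t <= r by near: t; exact: nbhs_right_le.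
have := @potential_le_neq0 x t 0.
rewrite normr0 (@powR0 _ k2) ?addr0 ?gt_eqF //.
have le : enorm t 0 <= delta by apply: enorm_le; rewrite ?normr0 // gtr0_norm.
move/(_ le) => H'; have : F x t 0 <= K * `|t| `^ k1.
  by apply: H' => -[t0']; move: t0; rewrite t0' ltxx.
lra.
Unshelve. all: by end_near. Qed.

Lemma potential_le x t s : enorm t s <= delta ->
  F x t s <= K * (`|t| `^ k1 + `|s| `^ k2).
Proof.
move=> d; have [[-> ->]|ts0] := pselect ((t, s) = (0, 0)); last exact: potential_le_neq0.
apply: le_trans (potential_le0 x) _.
by rewrite mulr_ge0 ?addr_ge0 ?powR_ge0 // ltW.
Qed.

Definition weighted_radial w : X :=
  row_pair (beta1^-1 *: row_fst w) (beta2^-1 *: row_snd w).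

Lemma continuous_weighted_radial : continuous weighted_radial.
Proof.
apply: continuous_rowP => i.
rewrite (_ : (fun t => _) = fun w => match enum_val i with
  | inl x => beta1^-1 * row_fst w x | inr x => beta2^-1 * row_snd w x end);
  last by apply/funext => w; rewrite mxE; case: (enum_val i).
case: (enum_val i) => x; apply: continuous_mul; try exact: cst_continuous.
  exact: continuous_row_fst.
exact: continuous_row_snd.
Qed.

Lemma weighted_radial_outward w (s : R) : 0 <= s ->
  `|w| <= `|w + s *: weighted_radial w|.
Proof.
move=> s0; apply/norm_rowP => // x.
have grow (b y : R) : 1 < b -> `|y| <= `|y + s * (b^-1 * y)|.
  move=> b1; have b0 : 0 <= b^-1 by rewrite invr_ge0; lra.
  rewrite mulrA -[X in `|X + _|]mul1r -mulrDl normrM ler_peMl //.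
  by rewrite ger0_norm ?lerDl ?addr_ge0 ?mulr_ge0.
split.
  apply: le_trans (norm_row_fst _ x).
  have -> : row_fst (w + s *: weighted_radial w) x =
      row_fst w x + s * row_fst (weighted_radial w) x by rewrite /row_fst !mxE.
  by rewrite row_pairK1; exact: grow.
apply: le_trans (norm_row_snd _ x).
have -> : row_snd (w + s *: weighted_radial w) x =
    row_snd w x + s * row_snd (weighted_radial w) x by rewrite /row_snd !mxE.
by rewrite row_pairK2; exact: grow.
Qed.

(* By (d), [J] decreases along [weighted_radial] wherever the energies exceed
   it. *)
Lemma system_grad_radial w : `|w| <= r ->
  dotrV (system_grad w) (weighted_radial w) <= system_functional w -
    (1 - p1 / beta1) * energy m1 p1 h1 (row_fst w) -
    (1 - p2 / beta2) * energy m2 p2 h2 (row_snd w).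
Proof.
move=> wr; rewrite system_gradE // row_pairK1 row_pairK2 /system_functional.
have -> : \sum_x energy_grad m1 p1 h1 (row_fst w) x * (beta1^-1 *: row_fst w) x =
    p1 / beta1 * energy m1 p1 h1 (row_fst w).
  rewrite mulrAC -energy_euler // mulr_suml; apply: eq_bigr => x _.
  by rewrite (_ : (beta1^-1 *: row_fst w) x = beta1^-1 * row_fst w x) //; ring.
have -> : \sum_x energy_grad m2 p2 h2 (row_snd w) x * (beta2^-1 *: row_snd w) x =
    p2 / beta2 * energy m2 p2 h2 (row_snd w).
  rewrite mulrAC -energy_euler // mulr_suml; apply: eq_bigr => x _.
  by rewrite (_ : (beta2^-1 *: row_snd w) x = beta2^-1 * row_snd w x) //; ring.
suff : \sum_x - (lambda * mu x) *
    (dt F x (row_fst w x) (row_snd w x) * (beta1^-1 *: row_fst w) x +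
     ds F x (row_fst w x) (row_snd w x) * (beta2^-1 *: row_snd w) x) <=
   \sum_x - (lambda * mu x) * F x (clamp r (row_fst w x)) (clamp r (row_snd w x)).
  lra.
apply: ler_sum => x _; rewrite row_fst_clamp // row_snd_clamp //.
rewrite ler_nM2l ?oppr_lt0 ?mulr_gt0 ?mu_gt0 //.
set t := row_fst w x; set s := row_snd w x.
rewrite (_ : (_ *: row_fst w) x = beta1^-1 * t) //.
rewrite (_ : (_ *: row_snd w) x = beta2^-1 * s) //.
have d : enorm t s <= delta.
  apply: enorm_le; first exact: le_trans (norm_row_fst _ _) wr.
  exact: le_trans (norm_row_snd _ _) wr.
have [[-> ->]|ts0] := pselect ((t, s) = (0, 0)).
  by rewrite !mulr0 addr0; exact: potential_le0.
have [_] := condD x d ts0.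
by move/le_trans; apply; rewrite le_eqVlt; apply/orP; left; apply/eqP; ring.
Qed.

(** Since [k1 > p1] and [k2 > p2], half of the zero-order part of the energies absorbs the potential
    at every vertex once [rho] is small; the other half stays positive on the sphere. *)
Lemma system_functional_sphere (muc hc1 hc2 e0 : R) : 0 < muc -> 0 < hc1 ->
  0 < hc2 -> (forall x, muc <= mu x) -> (forall x, hc1 <= h1 x) ->
  (forall x, hc2 <= h2 x) -> 0 < e0 ->
  exists rho alpha, [/\ 0 < rho <= e0, 0 < alpha &
    forall w, `|w| = rho -> alpha <= system_functional w].
Proof.
move=> muc0 hc10 hc20 mule h1le h2le e00.
have p1_gt0 : 0 < p1 by exact: lt_trans p1_gt1.
have p2_gt0 : 0 < p2 by exact: lt_trans p2_gt1.
have r_gt0 : 0 < r by rewrite mulr_gt0.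
have lK : 0 < lambda * K by rewrite mulr_gt0.
(* Half of the coefficient of |u|^p1, respectively |v|^p2, in the energy density. *)
pose c1 := hc1 / (2 * p1); pose c2 := hc2 / (2 * p2).
have c10 : 0 < c1 by rewrite divr_gt0 ?mulr_gt0.
have c20 : 0 < c2 by rewrite divr_gt0 ?mulr_gt0.
near (0 : R)^'+ => rho.
have rho0 : 0 < rho by near: rho; exact: nbhs_right_gt.
have rhoe : rho <= e0 by near: rho; exact: nbhs_right_le.
have rhor : rho <= r by near: rho; exact: nbhs_right_le.
have rho1 : rho `^ (k1 - p1) < c1 / (lambda * K).
  near: rho; apply: (cvgr_lt (0 : R)); last by rewrite divr_gt0.
  by apply: powR_cvg0; rewrite subr_gt0.
have rho2 : rho `^ (k2 - p2) < c2 / (lambda * K).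
  near: rho; apply: (cvgr_lt (0 : R)); last by rewrite divr_gt0.
  by apply: powR_cvg0; rewrite subr_gt0.
have absorb (p k c y : R) : 0 < p -> p < k -> rho `^ (k - p) < c / (lambda * K) ->
    0 <= y -> y <= rho -> lambda * K * y `^ k <= c * y `^ p.
  move=> pp pk rk y0 yrho.
  have -> : y `^ k = y `^ (k - p) * y `^ p.
    rewrite -powRD ?subrK //; apply/implyP => /eqP k0.
    by move: (lt_trans pp pk); rewrite k0 ltxx.
  rewrite mulrA ler_wpM2r ?powR_ge0 // mulrC -ler_pdivlMr //.
  by apply: le_trans (ltW rk); apply: ge0_ler_powR; rewrite ?nnegrE ?subr_ge0 // ltW.
exists rho, (muc * Num.min (c1 * rho `^ p1) (c2 * rho `^ p2)); split.
- by rewrite rho0.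
- apply: mulr_gt0 => //; rewrite lt_min.
  by apply/andP; split; apply: mulr_gt0 => //; exact: powR_gt0.
move=> w wrho; have wr : `|w| <= r by rewrite wrho.
pose T x := mu x * (c1 * `|row_fst w x| `^ p1 + c2 * `|row_snd w x| `^ p2).
have T0 x : 0 <= T x.
  apply: mulr_ge0; first exact/ltW/mu_gt0.
  by apply: addr_ge0; apply: mulr_ge0; rewrite ?powR_ge0 // ltW.
apply: (@le_trans _ _ (\sum_x T x)).
  (* A vertex that attains the norm contributes at least [alpha] alone; all other terms are
     nonnegative. *)
  have [x xw] : exists x, rho <= `|row_fst w x| \/ rho <= `|row_snd w x|.
    by apply: norm_row_ge => //; rewrite wrho.
  rewrite (bigD1 x) //= -[leLHS]addr0; apply: lerD; last by apply: sumr_ge0.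
  rewrite /T; apply: ler_pM.
  - exact: ltW.
  - by rewrite le_min; apply/andP; split; apply: mulr_ge0; rewrite ?powR_ge0 // ltW.
  - exact: mule.
  have mono (p y : R) : 0 < p -> rho <= y -> rho `^ p <= y `^ p.
    by move=> pp le; apply: ge0_ler_powR; rewrite ?nnegrE // ltW // (lt_le_trans rho0).
  rewrite ge_min; case: xw => xw; apply/orP; [left|right].
    apply: ler_wpDr; first by apply: mulr_ge0; rewrite ?powR_ge0 // ltW.
    by apply: ler_wpM2l; [exact: ltW|exact: mono].
  apply: ler_wpDl; first by apply: mulr_ge0; rewrite ?powR_ge0 // ltW.
  by apply: ler_wpM2l; [exact: ltW|exact: mono].
rewrite /system_functional.
apply: (@le_trans _ _ (p1^-1 * intV (fun x => h1 x * `|row_fst w x| `^ p1) +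
    p2^-1 * intV (fun x => h2 x * `|row_snd w x| `^ p2) +
    \sum_x - (lambda * mu x) *
      F x (clamp r (row_fst w x)) (clamp r (row_snd w x)))); last first.
  by rewrite lerD2r lerD // energy_ge_potential.
rewrite /intV !mulr_sumr -!big_split /=; apply: ler_sum => x _.
rewrite row_fst_clamp // row_snd_clamp // /T.
rewrite (_ : _ + _ + _ = mu x * (p1^-1 * h1 x * `|row_fst w x| `^ p1 +
  p2^-1 * h2 x * `|row_snd w x| `^ p2 - lambda * F x (row_fst w x) (row_snd w x)));
  last by ring.
rewrite ler_pM2l ?mu_gt0 //.
have ur : `|row_fst w x| <= rho by rewrite -wrho norm_row_fst.
have vr : `|row_snd w x| <= rho by rewrite -wrho norm_row_snd.
have d : enorm (row_fst w x) (row_snd w x) <= delta.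
  by apply: enorm_le; [exact: le_trans ur rhor|exact: le_trans vr rhor].
have Fle : lambda * F x (row_fst w x) (row_snd w x) <=
    lambda * (K * (`|row_fst w x| `^ k1 + `|row_snd w x| `^ k2)).
  by rewrite ler_pM2l //; exact: potential_le.
have a1 := absorb p1 k1 c1 _ p1_gt0 k1_gt rho1 (normr_ge0 _) ur.
have a2 := absorb p2 k2 c2 _ p2_gt0 k2_gt rho2 (normr_ge0 _) vr.
have half (p h hc y : R) : 0 < p -> hc <= h -> 0 <= y ->
    2 * (hc / (2 * p)) * y <= p^-1 * h * y.
  move=> pp hh y0; rewrite ler_wpM2r // (_ : 2 * (hc / (2 * p)) = p^-1 * hc).
    by rewrite ler_pM2l // invr_gt0.
  by field; rewrite gt_eqF.
have b1 := half p1 _ _ _ p1_gt0 (h1le x) (powR_ge0 `|row_fst w x| p1).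
have b2 := half p2 _ _ _ p2_gt0 (h2le x) (powR_ge0 `|row_snd w x| p2).
rewrite -/c1 in b1; rewrite -/c2 in b2.
move: Fle a1 a2 b1 b2; rewrite mulrA mulrDr; lra.
Unshelve. all: by end_near. Qed.

Section Solution.
Variables (q1 q2 M1 M2 : R).
Hypotheses (q1_gt : p1 < q1) (q2_gt : p2 < q2) (M1_gt0 : 0 < M1) (M2_gt0 : 0 < M2).
Hypothesis condB : forall x t s, enorm t s <= delta ->
  M1 * `|t| `^ q1 + M2 * `|s| `^ q2 <= F x t s.
Variables (muc hc1 hc2 : R).
Hypotheses (muc_gt0 : 0 < muc) (hc1_gt0 : 0 < hc1) (hc2_gt0 : 0 < hc2).
Hypothesis mu_ge : forall x : G, muc <= mu x.
Hypothesis h1_ge : forall x, hc1 <= h1 x.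
Hypothesis h2_ge : forall x, hc2 <= h2 x.

Lemma system_functional_ray (u0 v0 : G -> R) (t : R) : `|row_pair u0 v0| <= r ->
  0 <= t <= 1 ->
  system_functional (t *: row_pair u0 v0) <=
    (t `^ p1 * energy m1 p1 h1 u0 -
     lambda * (M1 * intV (fun x => `|u0 x| `^ q1) * t `^ q1)) +
    (t `^ p2 * energy m2 p2 h2 v0 -
     lambda * (M2 * intV (fun x => `|v0 x| `^ q2) * t `^ q2)).
Proof.
move=> er /andP[t0 t1].
have ter : `|t *: row_pair u0 v0| <= r.
  by rewrite normrZ ger0_norm // (le_trans _ er) // ler_piMl.
rewrite /system_functional row_fstZ row_sndZ row_pairK1 row_pairK2 !energyZ //.
suff : \sum_x - (lambda * mu x) *
      F x (clamp r ((t *: u0) x)) (clamp r ((t *: v0) x)) <=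
    - (lambda * (M1 * intV (fun x => `|u0 x| `^ q1) * t `^ q1)) -
      (lambda * (M2 * intV (fun x => `|v0 x| `^ q2) * t `^ q2)) by lra.
have -> : - (lambda * (M1 * intV (fun x => `|u0 x| `^ q1) * t `^ q1)) -
      (lambda * (M2 * intV (fun x => `|v0 x| `^ q2) * t `^ q2)) =
    \sum_x - (lambda * mu x) * (M1 * `|t * u0 x| `^ q1 + M2 * `|t * v0 x| `^ q2).
  rewrite /intV !mulr_sumr !mulr_suml !mulr_sumr -!sumrN -big_split /=.
  apply: eq_bigr => x _.
  by rewrite !normrM (ger0_norm t0) !powRM //; ring.
apply: ler_sum => x _; rewrite ler_nM2l ?oppr_lt0 ?mulr_gt0 ?mu_gt0 //.
have ur : `|(t *: u0) x| <= r.
  by have := le_trans (norm_row_fst _ x) ter; rewrite row_fstZ row_pairK1.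
have vr : `|(t *: v0) x| <= r.
  by have := le_trans (norm_row_snd _ x) ter; rewrite row_sndZ row_pairK2.
by rewrite !clamp_id //; apply: condB; exact: enorm_le.
Qed.

(** Keeps a single vertex and drops the gradient. It bounds the energies from below on the shell and
    later gives the uniform bound on solutions. *)
Lemma energy_ge_vertex m p (h : G -> R) (hc b : R) (u : G -> R) x : 1 < p -> 0 < hc ->
  (forall y, hc <= h y) -> 0 <= b -> b <= `|u x| ->
  muc * hc * b `^ p / p <= energy m p h u.
Proof.
move=> pp hc0 hle b0 bu; have p0 : 0 < p by exact: lt_trans pp.
apply: le_trans (energy_ge_potential m h pp u).
rewrite mulrC ler_pM2l ?invr_gt0 // /intV (bigD1 x) //=.
apply: ler_wpDr.
  apply: sumr_ge0 => y _; apply: mulr_ge0; first exact/ltW/mu_gt0.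
  by apply: mulr_ge0 (powR_ge0 _ _); rewrite (le_trans _ (hle y)) // ltW.
rewrite -mulrA; apply: ler_pM => //; first exact: ltW.
  by rewrite mulr_ge0 ?powR_ge0 // ltW.
apply: ler_pM => //; [exact: ltW|exact: powR_ge0|].
by apply: ge0_ler_powR; rewrite ?nnegrE // ltW.
Qed.

Lemma energy_ge0 m p (h u : G -> R) :
  1 < p -> (forall x, 0 < h x) -> 0 <= energy m p h u.
Proof.
move=> pp h0; rewrite mulr_ge0 ?invr_ge0 //; first by rewrite ltW // (lt_trans ltr01).
apply: sumr_ge0 => x _; apply: mulr_ge0; first exact/ltW/mu_gt0.
by rewrite addr_ge0 ?powR_ge0 // mulr_ge0 ?powR_ge0 // ltW.
Qed.

Lemma system_solution (u0 v0 : G -> R) (c : R) :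
  row_pair u0 v0 != 0 -> `|row_pair u0 v0| <= delta / 2 ->
  system_functional (row_pair u0 v0) <= 0 ->
  (forall t, 0 <= t <= 1 -> system_functional (t *: row_pair u0 v0) <= c) ->
  2 * c < (1 - p1 / beta1) * (muc * hc1 * (delta / 2) `^ p1 / p1) ->
  2 * c < (1 - p2 / beta2) * (muc * hc2 * (delta / 2) `^ p2 / p2) ->
  exists u v, [/\ (u, v) <> (cst 0, cst 0),
    weak_solution m1 m2 p1 p2 h1 h2 F lambda u v,
    (1 - p1 / beta1) * energy m1 p1 h1 u <= 2 * c &
    (1 - p2 / beta2) * energy m2 p2 h2 v <= 2 * c].
Proof.
set e := row_pair u0 v0 => e0 ed Je Jray c1 c2.
have e_gt0 : 0 < `|e| by rewrite normr_gt0.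
have b1 : 0 <= 1 - p1 / beta1.
  by rewrite subr_ge0 ler_pdivrMr ?mul1r ?ltW // (lt_trans ltr01).
have b2 : 0 <= 1 - p2 / beta2.
  by rewrite subr_ge0 ler_pdivrMr ?mul1r ?ltW // (lt_trans ltr01).
have [rho [alpha [rhoe alpha0 Jrho]]] := system_functional_sphere muc_gt0 hc1_gt0
  hc2_gt0 mu_ge h1_ge h2_ge e_gt0.
have [rho0 rho_le] := andP rhoe.
(* The segment from 0 to [e] crosses the sphere, so [c >= alpha]; this makes [c < 2 * c] strict. *)
have c0 : 0 < c.
  apply: (lt_le_trans alpha0); apply: le_trans (Jray (rho / `|e|) _).
    by apply: Jrho; rewrite normrZ normrM normfV normr_id divfK ?gt_eqF // gtr0_norm.
  by rewrite ler_pdivrMr // mul1r rho_le andbT divr_ge0 // ltW.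
have r1r : 3 / 5 * delta < r by rewrite /r ltr_pM2r //; lra.
have d2 : 0 <= delta / 2 by rewrite divr_ge0 // ltW.
(* The outer radius stays strictly below [r], since the strict estimate needs interior points of the
   square. *)
have [||||w [wr1 gw /andP[Jw0 Jw]]] := @local_mountain_pass _ _ system_functional
  system_grad weighted_radial e (delta / 2) (3 / 5 * delta) rho alpha c (2 * c)
  continuous_system_functional continuous_system_grad continuous_weighted_radial
  system_grad0 Je rhoe ed _ alpha0 Jrho Jray _ weighted_radial_outward.
- by lra.
- by lra.
- move=> w /andP[wr0 wr1] Jw.
  have wr : `|w| <= r by exact: le_trans wr1 (ltW r1r).
  apply: le_lt_trans (system_grad_radial wr) _.
  have E1 := mulr_ge0 b1 (energy_ge0 m1 (row_fst w) p1_gt1 h1_gt0).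
  have E2 := mulr_ge0 b2 (energy_ge0 m2 (row_snd w) p2_gt1 h2_gt0).
  (* On the shell some vertex carries a value of size at least [delta / 2], and the energy of that
     one component already exceeds the level [2 * c]. *)
  have [|x [ux|vx]] := norm_row_ge _ wr0; first by rewrite divr_gt0.
    have := ler_wpM2l b1 (energy_ge_vertex m1 p1_gt1 hc1_gt0 h1_ge d2 ux); lra.
  have := ler_wpM2l b2 (energy_ge_vertex m2 p2_gt1 hc2_gt0 h2_ge d2 vx); lra.
- move=> w V wr1; apply: strict_sub_descent; apply: system_strict_sub.
  exact: le_lt_trans wr1 r1r.
have wr : `|w| <= r by exact: le_trans wr1 (ltW r1r).
have := system_grad_radial wr; rewrite gw.
have -> : dotrV (0 : X) (weighted_radial w) = 0.
  by rewrite /dotrV big1 // => i _; rewrite mxE mul0r.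
have E1 := mulr_ge0 b1 (energy_ge0 m1 (row_fst w) p1_gt1 h1_gt0).
have E2 := mulr_ge0 b2 (energy_ge0 m2 (row_snd w) p2_gt1 h2_gt0).
move=> le; exists (row_fst w), (row_snd w); split; [|exact: system_weak_solution|lra|lra].
(* The zero pair is excluded by its level: [F x 0 0 >= 0] by (b), hence [J 0 <= 0], while the
   critical level is positive. *)
move=> [u_0 v_0]; move: Jw0; apply/negP; rewrite -leNgt.
rewrite /system_functional.
have z0 m p h : 1 < p -> energy m p h (cst 0 : G -> R) = 0.
  move=> pp; have -> : cst 0 = 0 *: (0 : G -> R) by apply/funext => y; rewrite scaler0.
  by rewrite energyZ // powR0 ?mul0r // gt_eqF // (lt_trans ltr01).
rewrite u_0 v_0 !z0 // !add0r; apply: sumr_le0 => x _.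
rewrite clamp_id ?normr0 //; apply: mulr_le0_ge0.
  by rewrite oppr_le0; apply: mulr_ge0; [exact: ltW|exact/ltW/mu_gt0].
apply: (@le_trans _ _ (M1 * `|0| `^ q1 + M2 * `|0| `^ q2)).
  by apply: addr_ge0; apply: mulr_ge0; rewrite ?powR_ge0 // ltW.
apply: condB.
by apply: enorm_le; rewrite normr0.
Qed.

End Solution.
End Growth.
End System.

(** * The mountain pass level *)

Section Numeric.
Context {R : realType}.

(* The tangent line of [y `^ (q / p)] at the maximum point of
   [A / p * y - lambda * D * y `^ (q / p)]. *)
Lemma power_difference_max (p q A D lambda t : R) : 1 < p -> p < q -> 0 < A ->
  0 < D -> 0 < lambda -> 0 <= t ->
  t `^ p * (A / p) - lambda * (D * t `^ q) <=
    (q - p) / p * (A / q * (A / (lambda * D * q)) `^ (p / (q - p))).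
Proof.
move=> p1 pq A0 D0 l0 t0; have p0 : 0 < p by exact: lt_trans p1.
have q0 : 0 < q by exact: lt_trans pq.
have qp : 0 < q - p by rewrite subr_gt0.
have s1 : 1 < q / p by rewrite ltr_pdivlMr // mul1r.
pose y := t `^ p; rewrite -/y.
set y0 := (A / _) `^ _.
have B0 : 0 < A / (lambda * D * q) by rewrite divr_gt0 // !mulr_gt0.
have y00 : 0 <= y0 by exact: powR_ge0.
have := powR_tangent s1 y00 (powR_ge0 t p).
have -> : y0 `^ (q / p - 1) = A / (lambda * D * q).
  rewrite /y0 -powRrM (_ : p / (q - p) * (q / p - 1) = 1) ?powRr1 ?ltW //.
  by field; rewrite !gt_eqF.
rewrite -(powRrM t) (_ : p * (q / p) = q) -/y; last by field; rewrite gt_eqF.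
have -> : y0 `^ (q / p) = A / (lambda * D * q) * y0.
  rewrite /y0 -powRrM (_ : p / (q - p) * (q / p) = 1 + p / (q - p)).
    rewrite powRD; last by apply/implyP => _; rewrite gt_eqF.
    by rewrite powRr1 // ltW.
  by field; rewrite !gt_eqF.
move=> tangent.
have c0 : 0 < lambda * D * (q / p) by rewrite !mulr_gt0 // invr_gt0.
have := tangent; rewrite -(ler_pM2l c0).
have -> : lambda * D * (q / p) * ((A / (lambda * D * q) * y0 - t `^ q) / (q / p)) =
    A / q * y0 - lambda * (D * t `^ q) by field; rewrite !gt_eqF.
have -> : lambda * D * (q / p) * (A / (lambda * D * q) * (y0 - y)) =
    A / p * y0 - y * (A / p) by field; rewrite !gt_eqF.
have -> : (q - p) / p * (A / q * y0) = A / p * y0 - A / q * y0.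
  by field; rewrite !gt_eqF.
lra.
Qed.

(** Identifies the maximum along the ray with C_{i,*} times a power of [lambda]. Both sides are
    products of positive powers, so taking logarithms leaves a rational identity. *)
Lemma power_difference_maxE (p q H N M L V lambda : R) : 1 < p -> p < q ->
  0 < H -> 0 < N -> 0 < M -> 0 < L -> 0 < V -> 0 < lambda ->
  (q - p) / p * (H * N / q *
    (H * N / (lambda * (M * L `^ q * V `^ (1 - q / p)) * q)) `^ (p / (q - p))) =
  (q - p) * V / p * (H `^ q / (q `^ q * M `^ p)) `^ (q - p)^-1 *
    (N `^ p^-1 / L) `^ (p * q / (q - p)) * lambda `^ (- (p / (q - p))).
Proof.
move=> p1 pq H0 N0 M0 L0 V0 l0; have p0 : 0 < p by exact: lt_trans p1.
have q0 : 0 < q by exact: lt_trans pq.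
have qp : 0 < q - p by rewrite subr_gt0.
rewrite (_ : (q - p) * V / p = (q - p) / p * V); last by ring.
rewrite -!mulrA; congr (_ * (_ * _)).
apply: ln_inj; do 4?rewrite ?posrE ?mulr_gt0 ?invr_gt0 ?powR_gt0 //.
have lnE := (lnM, lnV, ln_powR).
do 6!rewrite ?lnE; do 4?rewrite ?posrE ?mulr_gt0 ?invr_gt0 ?powR_gt0 //.
by field; rewrite !gt_eqF.
Qed.

End Numeric.

(** * Extrema over the vertices and Lebesgue norms *)

Section VertexBounds.
Context {R : realType} (G : wgraph R).
Implicit Types (u phi : G -> R) (x : G).

Lemma minV_le phi x : minV phi <= phi x.
Proof.
rewrite /minV; case: pickP => [x0 _|/(_ x)//].
exact: bigmin_le_cond.
Qed.

Lemma maxV_ge phi x : phi x <= maxV phi.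
Proof.
rewrite /maxV; case: pickP => [x0 _|/(_ x)//].
exact: le_bigmax.
Qed.

Lemma minV_gt0 phi x : (forall y, 0 < phi y) -> 0 < minV phi.
Proof.
move=> phi0; rewrite /minV; case: pickP => [x0 _|/(_ x)//].
by elim/big_rec : _ => // i y _ y0; rewrite lt_min phi0.
Qed.

Lemma maxV_attained phi x : exists y, maxV phi = phi y.
Proof.
rewrite /maxV; case: pickP => [x0 _|/(_ x)//].
elim/big_rec : _ => [|i y _ [z ->]]; first by exists x0.
by rewrite maxEle; case: ifP => _; [exists z|exists i].
Qed.

Lemma supnorm_gt0_vertex u : 0 < supnorm u -> exists x, 0 < `|u x|.
Proof.
rewrite /supnorm => u0; have [x _|noV] := pickP (fun _ : G => true).
  by have [y E] := maxV_attained (fun x => `|u x|) x; exists y; rewrite -E.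
by move: u0; rewrite /maxV; case: pickP => [x _|_]; [move: (noV x)|rewrite ltxx].
Qed.

Lemma intV_ge0 phi : (forall x, 0 <= phi x) -> 0 <= intV phi.
Proof. by move=> H; apply: sumr_ge0 => x _; rewrite mulr_ge0 // ltW ?mu_gt0. Qed.

Lemma lpnormK p u : 0 < p -> lpnorm p u `^ p = intV (fun x => `|u x| `^ p).
Proof.
move=> p0; rewrite /lpnorm -powRrM mulVf ?gt_eqF // powRr1 //.
by apply: intV_ge0 => x; exact: powR_ge0.
Qed.

Lemma intV_gt0 phi x : (forall y, 0 <= phi y) -> 0 < phi x -> 0 < intV phi.
Proof.
move=> H Hx; rewrite /intV (bigD1 x) //= ltr_wpDr ?mulr_gt0 ?mu_gt0 //.
by apply: sumr_ge0 => y _; rewrite mulr_ge0 // ltW ?mu_gt0.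
Qed.

Lemma lpnorm_gt0 p u x : 0 < `|u x| -> 0 < lpnorm p u.
Proof.
move=> ux; apply: powR_gt0; apply: (@intV_gt0 _ x) => [y|].
  exact: powR_ge0.
exact: powR_gt0.
Qed.

Lemma volV_gt0 x : 0 < volV G.
Proof.
rewrite /volV (bigD1 x) //= ltr_wpDr ?mu_gt0 //.
by apply: sumr_ge0 => y _; rewrite ltW ?mu_gt0.
Qed.

(* Jensen's inequality for [y `^ (q / p)]: sum its tangent lines at the mean. *)
Lemma lpnorm_power_mean p q u x : 0 < p -> p < q ->
  lpnorm p u `^ q * volV G `^ (1 - q / p) <= intV (fun x => `|u x| `^ q).
Proof.
move=> p0 pq; have V0 := volV_gt0 x; have q0 : 0 < q by exact: lt_trans pq.
have s1 : 1 < q / p by rewrite ltr_pdivlMr // mul1r.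
pose I := intV (fun y => `|u y| `^ p); pose m := I / volV G.
have I0 : 0 <= I by apply: intV_ge0 => y; exact: powR_ge0.
have m0 : 0 <= m by rewrite divr_ge0 // ltW.
have -> : lpnorm p u `^ q * volV G `^ (1 - q / p) = volV G * m `^ (q / p).
  rewrite /lpnorm -/I -powRrM (mulrC p^-1) /m powRM ?invr_ge0 ?(ltW V0) //.
  rewrite -(powR_inv1 (ltW V0)) -powRrM mulN1r.
  rewrite powRD; last by apply/implyP => _; rewrite gt_eqF.
  by rewrite powRr1 ?ltW // mulrCA (mulrC q).
have : \sum_y mu y * ((m `^ (q / p) - (`|u y| `^ p) `^ (q / p)) / (q / p)) <=
    \sum_y mu y * (m `^ (q / p - 1) * (m - `|u y| `^ p)).
  apply: ler_sum => y _; rewrite ler_pM2l ?mu_gt0 //.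
  by apply: powR_tangent => //; exact: powR_ge0.
have -> : \sum_y mu y * (m `^ (q / p - 1) * (m - `|u y| `^ p)) = 0.
  transitivity (m `^ (q / p - 1) * (m * volV G - I)).
    rewrite /volV /I /intV mulr_sumr -sumrB mulr_sumr.
    by apply: eq_bigr => y _; ring.
  by rewrite /m divfK ?gt_eqF // subrr mulr0.
have -> : \sum_y mu y * ((m `^ (q / p) - (`|u y| `^ p) `^ (q / p)) / (q / p)) =
    (volV G * m `^ (q / p) - intV (fun y => `|u y| `^ q)) / (q / p).
  rewrite /volV /intV mulr_suml -sumrB mulr_suml; apply: eq_bigr => y _.
  rewrite -powRrM (_ : p * (q / p) = q); first by ring.
  by field; rewrite gt_eqF.
by rewrite pmulr_lle0 ?subr_le0 // invr_gt0 divr_gt0.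
Qed.

Lemma energy_le_norms m p (h u : G -> R) : 1 < p ->
  energy m p h u <= (Num.max 1 (maxV h) *
    (lpnorm p (gradm m u) `^ p + lpnorm p u `^ p)) / p.
Proof.
move=> p1; have p0 : 0 < p by exact: lt_trans p1.
rewrite (lpnormK (gradm m u) p0) (lpnormK u p0) [leRHS]mulrC /energy.
rewrite ler_pM2l ?invr_gt0 // /intV -big_split.
rewrite mulr_sumr; apply: ler_sum => x _ /=.
rewrite -mulrDr mulrCA ler_pM2l ?mu_gt0 // mulrDr (ger0_norm (gradm_ge0 _ _ _)).
apply: lerD; first by rewrite ler_peMl ?powR_ge0 // le_max lexx.
by rewrite ler_wpM2r ?powR_ge0 // le_max maxV_ge orbT.
Qed.

End VertexBounds.

(** The energy is bounded above through the norms and the potential below through the power mean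
    inequality; what remains is the one-variable maximum, whose value is C_{i,*}
    lambda^(-p/(q-p)). *)
Lemma energy_ray_level {R : realType} (G : wgraph R) m (p q M lambda t : R)
    (h u : G -> R) x :
  1 < p -> p < q -> 0 < M -> 0 < lambda -> 0 <= t -> 0 < `|u x| ->
  t `^ p * energy m p h u - lambda * (M * intV (fun x => `|u x| `^ q) * t `^ q) <=
  (q - p) * volV G / p *
    (Num.max 1 (maxV h) `^ q / (q `^ q * M `^ p)) `^ (q - p)^-1 *
    ((lpnorm p (gradm m u) `^ p + lpnorm p u `^ p) `^ p^-1 / lpnorm p u)
      `^ (p * q / (q - p)) * lambda `^ (- (p / (q - p))).
Proof.
move=> p1 pq M0 l0 t0 ux; have p0 : 0 < p by exact: lt_trans p1.
have L0 : 0 < lpnorm p u by exact: lpnorm_gt0 ux.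
have H0 : 0 < Num.max 1 (maxV h) by rewrite lt_max ltr01.
have V0 := volV_gt0 x.
set N := lpnorm p (gradm m u) `^ p + lpnorm p u `^ p.
have N0 : 0 < N by apply: ltr_wpDl; [exact: powR_ge0|exact: powR_gt0].
rewrite -power_difference_maxE //.
set D := M * lpnorm p u `^ q * volV G `^ (1 - q / p).
have D0 : 0 < D.
  by apply: mulr_gt0 (powR_gt0 _ V0); exact: mulr_gt0 M0 (powR_gt0 _ L0).
apply: le_trans (power_difference_max p1 pq (mulr_gt0 H0 N0) D0 l0 t0).
apply: lerB.
  by apply: ler_wpM2l; [exact: powR_ge0|exact: energy_le_norms].
rewrite ler_pM2l // ler_wpM2r ?powR_ge0 // /D -mulrA ler_pM2l //.
exact: (lpnorm_power_mean u x p0 pq).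
Qed.

Lemma level_lt {R : realType} (p theta beta c1 c2 C e1 e2 delta k lambda : R) :
  1 < p -> p < theta -> theta <= beta -> c1 <= C -> c2 <= C -> 0 < C ->
  0 < e1 -> 0 < e2 -> 0 < delta -> 0 < k -> 0 < lambda ->
  let num := 2 `^ (2 * p + 1) * p * theta * C in
  let den := delta `^ p * (theta - p) * k - num in
  0 < den -> (num / den) `^ (Num.max e1 e2)^-1 < lambda ->
  2 * (c1 * lambda `^ (- e1) + c2 * lambda `^ (- e2)) <
    (1 - p / beta) * (k * (delta / 2) `^ p / p).
Proof.
move=> p1 ptheta tb c1C c2C C0 e10 e20 d0 k0 l0 num den den0 lamb.
have p0 : 0 < p by exact: lt_trans p1.
have th0 : 0 < theta by exact: lt_trans ptheta.
set E := Num.max e1 e2 in lamb *.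
have E0 : 0 < E by rewrite lt_max e10.
have num0 : 0 < num.
  by apply: mulr_gt0 C0; apply: mulr_gt0 th0; apply: mulr_gt0 p0; exact: powR_gt0.
have lE : num / den < lambda `^ E.
  have nd : 0 <= num / den by rewrite divr_ge0 // ltW.
  rewrite -[num / den]powRr1 // -(mulVf (lt0r_neq0 E0)) powRrM.
  by apply: gt0_ltr_powR; rewrite ?nnegrE ?powR_ge0 // ltW.
set L := lambda `^ (- E).
have L0 : 0 < L by exact: powR_gt0.
have LE : L * lambda `^ E = 1 by rewrite /L powRN mulVf // gt_eqF ?powR_gt0.
(* Which exponent dominates depends on whether [lambda <= 1]: the power is at most [L] in that case
   and at most 1 otherwise, so [1 + L] covers both. *)
have small e : 0 < e -> e <= E -> lambda `^ (- e) <= 1 + L.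
  move=> ee eE; have [l1|/ltW l1] := leP lambda 1.
    apply: ler_wpDl => //; apply: ger_powR; first by rewrite l0.
    by rewrite lerN2.
  apply: ler_wpDr; first exact: ltW.
  rewrite powRN invf_le1 ?powR_gt0 // -(powRr0 lambda); apply: ler_powR => //.
  exact: ltW.
have s1 : lambda `^ (- e1) <= 1 + L by apply: small => //; rewrite le_max lexx.
have s2 : lambda `^ (- e2) <= 1 + L by apply: small => //; rewrite le_max lexx orbT.
have numL : num * (1 + L) < delta `^ p * (theta - p) * k.
  have : num < den * lambda `^ E by rewrite mulrC -ltr_pdivrMr.
  rewrite -(ltr_pM2r L0) -[ltRHS]mulrA (mulrC (lambda `^ E) L) LE mulr1.
  have -> : num * (1 + L) = num + num * L by ring.
  by rewrite -ltrBrDl.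
have sum_le : c1 * lambda `^ (- e1) + c2 * lambda `^ (- e2) <= 2 * C * (1 + L).
  have t c e : c <= C -> lambda `^ (- e) <= 1 + L -> c * lambda `^ (- e) <= C * (1 + L).
    move=> cC le; apply: (@le_trans _ _ (C * lambda `^ (- e))).
      by rewrite ler_wpM2r ?powR_ge0.
    by rewrite ler_pM2l.
  by have := t _ _ c1C s1; have := t _ _ c2C s2; lra.
set P := (2 : R) `^ p.
have P2 : 2 <= P.
  by rewrite -[leLHS](powRr1 (ler0n _ 2)); apply: ler_powR; [rewrite ler1n|exact: ltW].
have P0 : 0 < P by exact: powR_gt0.
have pow2 : (2 : R) `^ (2 * p + 1) = 2 * P ^+ 2.
  rewrite powRD; last by apply/implyP => _; rewrite pnatr_eq0.
  by rewrite powRr1 // mulrC mulrC (mulrC 2 p) powRrM powR_mulrn ?powR_ge0 // mulrC.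
have dP : (delta / 2) `^ p = delta `^ p / P.
  rewrite powRM ?invr_ge0 ?ltW // -[in RHS]powRN -[2^-1]powR_inv1 // -powRrM mulN1r.
  by [].
have beta0 : 0 < beta by exact: lt_le_trans tb.
rewrite dP; set W := delta `^ p in numL *.
have W0 : 0 < W by exact: powR_gt0.
have coef : 1 - p / theta <= 1 - p / beta.
  by rewrite lerB // ler_pM2l // lef_pV2.
have coef0 : 0 < 1 - p / theta by rewrite subr_gt0 ltr_pdivrMr // mul1r.
(* [num] carries two factors 2^p while halving [delta] costs only one; the spare factor [2 / P] is
   at most 1. *)
apply: (@lt_le_trans _ _ (2 * (W * (1 - p / theta) * k / (P ^+ 2 * p)))).
  apply: (@le_lt_trans _ _ (2 * (2 * C * (1 + L)))); first by rewrite ler_pM2l.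
  rewrite ltr_pM2l // ltr_pdivlMr; last by rewrite mulr_gt0 // exprn_gt0.
  have -> : 2 * C * (1 + L) * (P ^+ 2 * p) = num * (1 + L) / theta.
    by rewrite /num pow2; field; rewrite gt_eqF.
  by rewrite ltr_pdivrMr //; apply: lt_le_trans numL _;
    rewrite le_eqVlt; apply/orP; left; apply/eqP; field; rewrite gt_eqF.
have -> : 2 * (W * (1 - p / theta) * k / (P ^+ 2 * p)) =
    (1 - p / theta) * (k * (W / P) / p) * (2 / P) by field; rewrite !gt_eqF.
have K0 : 0 < k * (W / P) / p by rewrite !divr_gt0 // mulr_gt0 // divr_gt0.
apply: (@le_trans _ _ ((1 - p / theta) * (k * (W / P) / p))).
  by rewrite ler_piMr ?ler_pdivrMr ?mul1r // ltW // mulr_gt0.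
by rewrite ler_pM2r.
Qed.

(** * Limits as [lambda] tends to infinity *)

Lemma cvg_powRN_pinfty {R : realType} (e : R) : 0 < e ->
  (fun x : R => x `^ (- e)) @ +oo --> (0 : R).
Proof.
move=> e0; apply/cvgrPdist_lt => eps eps0; near=> x.
rewrite sub0r normrN ger0_norm ?powR_ge0 // powRN.
have x0 : 0 < x by near: x; exact: nbhs_pinfty_gt.
rewrite invf_plt ?posrE ?powR_gt0 //.
rewrite -[eps^-1]powRr1 ?invr_ge0 ?ltW // -(mulVf (lt0r_neq0 e0)) powRrM.
have big : eps^-1 `^ e^-1 < x by near: x; exact: nbhs_pinfty_gt.
by apply: gt0_ltr_powR; rewrite ?nnegrE ?powR_ge0 // ltW.
Unshelve. all: by end_near. Qed.

Lemma sobnorm_energy {R : realType} (G : wgraph R) m (p : R) (h u : G -> R) :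
  0 < p -> sobnorm m p h u = (p * energy m p h u) `^ p^-1.
Proof. by move=> p0; rewrite /sobnorm /energy mulVKf // gt_eqF. Qed.

Lemma pair_supnorm_le {R : realType} (G : wgraph R) (u v : G -> R) (a b : R) (x : G) :
  (forall y, `|u y| <= a) -> (forall y, `|v y| <= b) -> pair_supnorm u v <= a + b.
Proof.
move=> ua vb; rewrite /pair_supnorm.
have [y ->] := maxV_attained (fun y => enorm (u y) (v y)) x.
apply: le_trans (lerD (ua y) (vb y)).
rewrite /enorm -[leRHS]ger0_norm ?addr_ge0 // -sqrtr_sqr ler_wsqrtr //.
rewrite -(real_normK (num_real (u y))) -(real_normK (num_real (v y))).
have a0 := normr_ge0 (u y); have b0 := normr_ge0 (v y); nra.
Qed.

Lemma vertex_le_energy {R : realType} (G : wgraph R) m (p c b muc hc : R)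
    (h u : G -> R) x :
  1 < p -> 0 < muc -> 0 < hc -> (forall y : G, muc <= mu y) ->
  (forall y, hc <= h y) -> 0 < b -> b * energy m p h u <= c ->
  `|u x| <= `|p / (muc * hc * b) * c| `^ p^-1.
Proof.
move=> p1 muc0 hc0 mule hle b0 le; have p0 : 0 < p by exact: lt_trans p1.
have E := energy_ge_vertex muc0 mule m p1 hc0 hle (normr_ge0 (u x)) (lexx _).
have K0 : 0 < muc * hc * b by rewrite !mulr_gt0.
have up : `|u x| `^ p <= p / (muc * hc * b) * c.
  rewrite mulrAC ler_pdivlMr // mulrC.
  have := ler_wpM2l (ltW p0) (le_trans (ler_wpM2l (ltW b0) E) le).
  congr (_ <= _); by field; rewrite gt_eqF.
have c0 : 0 <= p / (muc * hc * b) * c by apply: le_trans up; exact: powR_ge0.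
rewrite (ger0_norm c0) -[leLHS]powRr1 // -(mulfV (lt0r_neq0 p0)) powRrM.
by apply: ge0_ler_powR; rewrite ?nnegrE ?invr_ge0 ?powR_ge0 // ltW.
Qed.

Lemma energy_le_root {R : realType} (G : wgraph R) m (p c b : R) (h u : G -> R) :
  1 < p -> (forall x, 0 < h x) -> 0 < b -> b * energy m p h u <= c ->
  sobnorm m p h u <= `|p / b * c| `^ p^-1.
Proof.
move=> p1 h0 b0 le; have p0 : 0 < p by exact: lt_trans p1.
rewrite sobnorm_energy //.
have E0 := energy_ge0 m u p1 h0.
have up : p * energy m p h u <= p / b * c.
  by rewrite -mulrA ler_pM2l // mulrC ler_pdivlMr // mulrC.
apply: ge0_ler_powR; rewrite ?nnegrE ?normr_ge0 //.
- by rewrite invr_ge0 ltW.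
- by rewrite mulr_ge0 // ltW.
- exact: (le_trans up (ler_norm _)).
Qed.

(** The absolute value allows the limit to be taken without a sign condition on [c]. *)
Lemma root_cvg0 {R : realType} (c : R -> R) (k p : R) : 0 < p ->
  c @ +oo --> (0 : R) -> (fun x => `|k * c x| `^ p^-1) @ +oo --> (0 : R).
Proof.
move=> p0 c0.
have kc : (fun x => k * c x) @ +oo --> (0 : R).
  by rewrite -(mulr0 k); exact: (cvgM (cvg_cst k) c0).
have pV : 0 < p^-1 by rewrite invr_gt0.
have := cvg_comp _ _ kc (@continuous_norm_powR R _ pV 0).
by rewrite normr0 powR0 // gt_eqF.
Qed.
Lemma ray_levels_cvg0 {R : realType} (C1 C2 e1 e2 : R) : 0 < e1 -> 0 < e2 ->
  (fun x : R => 2 * (C1 * x `^ (- e1) + C2 * x `^ (- e2))) @ +oo --> (0 : R).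
Proof.
move=> e10 e20.
have lim C e : 0 < e -> (fun x : R => C * x `^ (- e)) @ +oo --> (0 : R).
  by move=> e0; rewrite -(mulr0 C); exact: (cvgM (cvg_cst C) (cvg_powRN_pinfty e0)).
rewrite (_ : (0 : R) = 2 * (0 + 0)); last by rewrite addr0 mulr0.
exact: (cvgM (cvg_cst (2 : R)) (cvgD (lim C1 e1 e10) (lim C2 e2 e20))).
Qed.

Lemma ray_level_gt0 {R : realType} (p q M H N L V : R) : 0 < p -> p < q ->
  0 < M -> 0 < H -> 0 < N -> 0 < L -> 0 < V ->
  0 < (q - p) * V / p * (H `^ q / (q `^ q * M `^ p)) `^ (q - p)^-1 *
    (N `^ p^-1 / L) `^ (p * q / (q - p)).
Proof.
move=> p0 pq M0 H0 N0 L0 V0; have q0 : 0 < q by exact: lt_trans pq.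
apply: mulr_gt0; last by apply: powR_gt0; rewrite divr_gt0 ?powR_gt0.
apply: mulr_gt0.
  by apply: divr_gt0 => //; apply: mulr_gt0 => //; rewrite subr_gt0.
apply: powR_gt0; apply: divr_gt0; first exact: powR_gt0.
by apply: mulr_gt0; exact: powR_gt0.
Qed.

(** The bound on [lambda] is Lambda4: the norm bound on the two energies divided by the power mean
    lower bound on the potential, so that [J] is nonpositive at the end [t = 1] of the ray. *)
Lemma system_functional_endpoint {R : realType} (G : wgraph R) (m1 m2 : nat)
    (p1 p2 q1 q2 M1 M2 delta lambda : R) (h1 h2 : G -> R) (F : G -> R -> R -> R)
    (u0 v0 : G -> R) (x0 y0 : G) :
  1 < p1 -> 1 < p2 -> p1 < q1 -> p2 < q2 -> 0 < M1 -> 0 < M2 -> 0 < lambda ->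
  (forall x t s, enorm t s <= delta ->
    M1 * `|t| `^ q1 + M2 * `|s| `^ q2 <= F x t s) ->
  `|row_pair u0 v0| <= 2 / 3 * delta -> 0 < `|u0 x0| -> 0 < `|v0 y0| ->
  (p1^-1 * Num.max 1 (maxV h1) *
     (lpnorm p1 (gradm m1 u0) `^ p1 + lpnorm p1 u0 `^ p1) +
   p2^-1 * Num.max 1 (maxV h2) *
     (lpnorm p2 (gradm m2 v0) `^ p2 + lpnorm p2 v0 `^ p2)) /
  (M1 * lpnorm p1 u0 `^ q1 * volV G `^ (1 - q1 / p1) +
   M2 * lpnorm p2 v0 `^ q2 * volV G `^ (1 - q2 / p2)) < lambda ->
  system_functional m1 m2 p1 p2 h1 h2 F delta lambda (row_pair u0 v0) <= 0.
Proof.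
move=> p11 p21 pq1 pq2 M10 M20 l0 condB er ux vy.
have p1_gt0 : 0 < p1 by exact: lt_trans p11.
have p2_gt0 : 0 < p2 by exact: lt_trans p21.
have V0 := volV_gt0 x0.
have D_gt0 p q M (u : G -> R) x : 0 < M -> 0 < `|u x| ->
    0 < M * lpnorm p u `^ q * volV G `^ (1 - q / p).
  move=> M0 u0x; apply: mulr_gt0 (powR_gt0 _ V0).
  exact: (mulr_gt0 M0 (powR_gt0 _ (lpnorm_gt0 _ u0x))).
have D1 := D_gt0 p1 q1 M1 u0 x0 M10 ux; have D2 := D_gt0 p2 q2 M2 v0 y0 M20 vy.
rewrite ltr_pdivrMr ?addr_gt0 // [ltRHS]mulrDr => L4.
have I1 := ler_wpM2l (ltW M10) (lpnorm_power_mean u0 x0 p1_gt0 pq1).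
have I2 := ler_wpM2l (ltW M20) (lpnorm_power_mean v0 x0 p2_gt0 pq2).
have {}I1 := ler_wpM2l (ltW l0) I1; have {}I2 := ler_wpM2l (ltW l0) I2.
rewrite [M1 * (_ * _)]mulrA in I1; rewrite [M2 * (_ * _)]mulrA in I2.
have E1 := energy_le_norms m1 h1 u0 p11; have E2 := energy_le_norms m2 h2 v0 p21.
rewrite mulrC mulrA in E1; rewrite mulrC mulrA in E2.
have t01 : 0 <= (1 : R) <= 1 by rewrite ler01 lexx.
have := system_functional_ray m1 m2 p1 p2 h1 h2 l0 condB er t01.
rewrite scale1r !powR1 !mul1r !mulr1 => /le_trans; apply.
rewrite addrACA -opprD subr_le0; apply: (le_trans (lerD E1 E2)).
exact: (le_trans (ltW L4) (lerD I1 I2)).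
Qed.

Lemma max6_ge {R : realType} (a b c d e f : R) :
  let m := Num.max a (Num.max b (Num.max c (Num.max d (Num.max e f)))) in
  [/\ d <= m, e <= m & f <= m].
Proof. by rewrite /= !le_max !lexx !orbT. Qed.

Theorem theorem1p1 (R : realType) (G : wgraph R) (m1 m2 : nat) (p1 p2 : R)
  (h1 h2 : G -> R) (F : G -> R -> R -> R)
  (delta q1 q2 M1 M2 k1 k2 M3 M4 beta1 beta2 : R) (u0 v0 : G -> R)
  (m1_ge1 : (1 <= m1)%N) (m2_ge1 : (1 <= m2)%N)
  (p1_gt1 : 1 < p1) (p2_gt1 : 1 < p2)
  (h1_gt0 : forall x, 0 < h1 x) (h2_gt0 : forall x, 0 < h2 x)
  (delta_gt0 : 0 < delta)
  (condA : forall x, C1_on_disc F delta x)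
  (q1_gt : p1 < q1) (q2_gt : p2 < q2) (M1_gt0 : 0 < M1) (M2_gt0 : 0 < M2)
  (condB : forall x t s, enorm t s <= delta ->
    M1 * `|t| `^ q1 + M2 * `|s| `^ q2 <= F x t s)
  (k1_itv : p1 < k1 < q1) (k2_itv : p2 < k2 < q2)
  (k_gt_p : Num.max p1 p2 < Num.min k1 k2)
  (M3_gt0 : 0 < M3) (M4_gt0 : 0 < M4)
  (condCt : forall x t s, enorm t s <= delta ->
    `|dt F x t s| <=
      M3 * `|t| `^ (k1 - 1) + M4 * `|s| `^ (k2 * (k1 - 1) / k1))
  (condCs : forall x t s, enorm t s <= delta ->
    `|ds F x t s| <=
      M3 * `|t| `^ (k1 * (k2 - 1) / k2) + M4 * `|s| `^ (k2 - 1))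
  (beta1_gt : p1 < beta1) (beta2_gt : p2 < beta2)
  (condD : forall x t s, enorm t s <= delta -> (t, s) <> (0, 0) ->
    0 < F x t s /\
    F x t s <= beta1^-1 * (t * dt F x t s) + beta2^-1 * (s * ds F x t s))
  (u0_bnd : 0 < supnorm u0 <= delta / 2)
  (v0_bnd : 0 < supnorm v0 <= delta / 2) :
  let theta1 := Num.min beta1 k1 in
  let theta2 := Num.min beta2 k2 in
  let M5 := k1^-1 * (M3 + M4) in
  let M6 := ((k1 - 1) / k1 + k2^-1) * M4 in
  let h1min := minV h1 in let h1max := maxV h1 in
  let h2min := minV h2 in let h2max := maxV h2 in
  let mumin := minV (@mu R G) in
  let pmax := Num.max p1 p2 in
  let kmin := Num.min k1 k2 in
  let Lambda1 :=
    2 `^ (1 - pmax) / pmax *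
    (M5 / (mumin `^ ((k1 - p1) / p1) * h1min `^ (k1 / p1)) +
     M6 / (mumin `^ ((k2 - p2) / p2) * h2min `^ (k2 / p2)))^-1 in
  let Lambda2 :=
    Lambda1 * (6 * h1min `^ p1^-1 * lpnorm p1 u0) `^ (pmax - kmin) in
  let Lambda3 :=
    Lambda1 * (3 * h2min `^ p2^-1 * lpnorm p2 v0) `^ (pmax - kmin) in
  let N1 := lpnorm p1 (gradm m1 u0) `^ p1 + lpnorm p1 u0 `^ p1 in
  let N2 := lpnorm p2 (gradm m2 v0) `^ p2 + lpnorm p2 v0 `^ p2 in
  let Lambda4 :=
    (p1^-1 * Num.max 1 h1max * N1 + p2^-1 * Num.max 1 h2max * N2) /
    (M1 * lpnorm p1 u0 `^ q1 * volV G `^ (1 - q1 / p1) +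
     M2 * lpnorm p2 v0 `^ q2 * volV G `^ (1 - q2 / p2)) in
  let C1 :=
    (q1 - p1) * volV G / p1 *
    (Num.max 1 h1max `^ q1 / (q1 `^ q1 * M1 `^ p1)) `^ (q1 - p1)^-1 *
    (N1 `^ p1^-1 / lpnorm p1 u0) `^ (p1 * q1 / (q1 - p1)) in
  let C2 :=
    (q2 - p2) * volV G / p2 *
    (Num.max 1 h2max `^ q2 / (q2 `^ q2 * M2 `^ p2)) `^ (q2 - p2)^-1 *
    (N2 `^ p2^-1 / lpnorm p2 v0) `^ (p2 * q2 / (q2 - p2)) in
  let num1 := 2 `^ (2 * p1 + 1) * p1 * theta1 * Num.max C1 C2 in
  let num2 := 2 `^ (2 * p2 + 1) * p2 * theta2 * Num.max C1 C2 in
  let den1 := delta `^ p1 * (theta1 - p1) * mumin * h1min - num1 in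
  let den2 := delta `^ p2 * (theta2 - p2) * mumin * h2min - num2 in
  let expo := (Num.max (p1 / (q1 - p1)) (p2 / (q2 - p2)))^-1 in
  let Lambda5 := Num.max ((num1 / den1) `^ expo) ((num2 / den2) `^ expo) in
  let lambda_star :=
    Num.max Lambda1
      (Num.max Lambda2 (Num.max Lambda3 (Num.max Lambda4 Lambda5))) in
  (* Lambda5 is a real power of num_i / den_i, hence defined only if these
     quotients are those of positive numbers *)
  0 < den1 -> 0 < den2 ->
  exists u v : R -> G -> R,
    [/\ forall lambda, lambda_star < lambda ->
          (u lambda, v lambda) <> (cst 0, cst 0) /\
          weak_solution m1 m2 p1 p2 h1 h2 F lambda (u lambda) (v lambda),
        sobnorm m1 p1 h1 (u lambda) + sobnorm m2 p2 h2 (v lambda)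
          @[lambda --> +oo] --> (0 : R) &
        pair_supnorm (u lambda) (v lambda) @[lambda --> +oo] --> (0 : R)].
Proof.
move=> theta1 theta2 M5 M6 h1min h1max h2min h2max mumin pmax kmin Lambda1
  Lambda2 Lambda3 N1 N2 Lambda4 C1 C2 num1 num2 den1 den2 expo Lambda5
  lambda_star den1_gt0 den2_gt0.
have [star4 star51 star52] : [/\ Lambda4 <= lambda_star,
    (num1 / den1) `^ expo <= lambda_star & (num2 / den2) `^ expo <= lambda_star].
  exact: max6_ge.
clearbody lambda_star; clear Lambda1 Lambda2 Lambda3 Lambda5 pmax kmin M5 M6.
have [k1_gt _] := andP k1_itv; have [k2_gt _] := andP k2_itv.
have [u0_pos u0_le] := andP u0_bnd; have [v0_pos v0_le] := andP v0_bnd.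
have [x0 ux0] := supnorm_gt0_vertex u0_pos.
have [y0 vy0] := supnorm_gt0_vertex v0_pos.
have p1_gt0 : 0 < p1 by exact: lt_trans p1_gt1.
have p2_gt0 : 0 < p2 by exact: lt_trans p2_gt1.
have V0 := volV_gt0 x0.
have C1_gt0 : 0 < C1.
  apply: ray_level_gt0; rewrite ?lt_max ?ltr01 ?(lpnorm_gt0 _ ux0) //.
  by apply: ltr_wpDl; [exact: powR_ge0|exact/powR_gt0/(lpnorm_gt0 _ ux0)].
have C2_gt0 : 0 < C2.
  apply: ray_level_gt0; rewrite ?lt_max ?ltr01 ?(lpnorm_gt0 _ vy0) //.
  by apply: ltr_wpDl; [exact: powR_ge0|exact/powR_gt0/(lpnorm_gt0 _ vy0)].
have ray1 lambda t : 0 < lambda -> 0 <= t -> t `^ p1 * energy m1 p1 h1 u0 -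
    lambda * (M1 * intV (fun x => `|u0 x| `^ q1) * t `^ q1) <=
    C1 * lambda `^ (- (p1 / (q1 - p1))).
  by move=> l0 t0; exact: (energy_ray_level m1 h1 p1_gt1 q1_gt M1_gt0 l0 t0 ux0).
have ray2 lambda t : 0 < lambda -> 0 <= t -> t `^ p2 * energy m2 p2 h2 v0 -
    lambda * (M2 * intV (fun x => `|v0 x| `^ q2) * t `^ q2) <=
    C2 * lambda `^ (- (p2 / (q2 - p2))).
  by move=> l0 t0; exact: (energy_ray_level m2 h2 p2_gt1 q2_gt M2_gt0 l0 t0 vy0).
clearbody C1 C2.
have mumin_gt0 : 0 < mumin by apply: (minV_gt0 x0); exact: mu_gt0.
have h1min_gt0 : 0 < h1min by apply: (minV_gt0 x0).
have h2min_gt0 : 0 < h2min by apply: (minV_gt0 x0).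
have theta1_gt : p1 < theta1 by rewrite lt_min beta1_gt.
have theta2_gt : p2 < theta2 by rewrite lt_min beta2_gt.
have b1_gt0 : 0 < 1 - p1 / beta1.
  by rewrite subr_gt0 ltr_pdivrMr ?mul1r // (lt_trans p1_gt0).
have b2_gt0 : 0 < 1 - p2 / beta2.
  by rewrite subr_gt0 ltr_pdivrMr ?mul1r // (lt_trans p2_gt0).
have e1_gt0 : 0 < p1 / (q1 - p1) by rewrite divr_gt0 // subr_gt0.
have e2_gt0 : 0 < p2 / (q2 - p2) by rewrite divr_gt0 // subr_gt0.
pose c lambda := C1 * lambda `^ (- (p1 / (q1 - p1))) +
  C2 * lambda `^ (- (p2 / (q2 - p2))).
have c_cvg0 : (fun lambda => 2 * c lambda) @ +oo --> (0 : R).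
  exact: ray_levels_cvg0.
pose solves lambda (uv : (G -> R) * (G -> R)) := [/\ uv <> (cst 0, cst 0),
  weak_solution m1 m2 p1 p2 h1 h2 F lambda uv.1 uv.2,
  (1 - p1 / beta1) * energy m1 p1 h1 uv.1 <= 2 * c lambda &
  (1 - p2 / beta2) * energy m2 p2 h2 uv.2 <= 2 * c lambda].
have sol lambda : lambda_star < lambda -> exists uv, solves lambda uv.
  move=> star; have L4 := le_lt_trans star4 star.
  have L51 := le_lt_trans star51 star; have L52 := le_lt_trans star52 star.
  (* Lambda5 is a maximum of real powers, hence nonnegative, and [lambda] exceeds it. *)
  have lambda_gt0 : 0 < lambda by apply: le_lt_trans L51; exact: powR_ge0.
  set e := row_pair u0 v0.
  (* The row norm takes the larger of the two suprema, so no factor sqrt 2 appears. *)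
  have ed : `|e| <= delta / 2.
    apply/norm_rowP; first by rewrite divr_ge0 // ltW.
    move=> x; rewrite row_pairK1 row_pairK2.
    by split; [apply: le_trans u0_le|apply: le_trans v0_le];
      [exact: (maxV_ge (fun x => `|u0 x|))|exact: (maxV_ge (fun x => `|v0 x|))].
  have er : `|e| <= 2 / 3 * delta.
    by apply: le_trans ed _; rewrite mulrC ler_pM2r //; lra.
  have e0 : e != 0.
    rewrite -normr_gt0; apply: (lt_le_trans ux0).
    by have := norm_row_fst e x0; rewrite row_pairK1.
  have Cmax : 0 < Num.max C1 C2 by rewrite lt_max C1_gt0.
  have [||||u [v [uv0 weak E1 E2]]] := @system_solution R G m1 m2 p1 p2 h1 h2 F
    delta lambda p1_gt1 p2_gt1 h1_gt0 h2_gt0 delta_gt0 lambda_gt0 condA k1 k2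
    M3 M4 beta1 beta2 k1_gt k2_gt M3_gt0 M4_gt0 condCt condCs beta1_gt beta2_gt
    condD q1 q2 M1 M2 M1_gt0 M2_gt0 condB mumin h1min h2min mumin_gt0 h1min_gt0
    h2min_gt0 (minV_le _) (minV_le _) (minV_le _) u0 v0 (c lambda) e0 ed.
  - exact: (system_functional_endpoint p1_gt1 p2_gt1 q1_gt q2_gt M1_gt0 M2_gt0
      lambda_gt0 condB er ux0 vy0 L4).
  - move=> t t01; have [t0 _] := andP t01.
    apply: le_trans (system_functional_ray m1 m2 p1 p2 h1 h2 lambda_gt0 condB er t01) _.
    by apply: lerD; [exact: ray1|exact: ray2].
  - apply: (level_lt (theta := theta1) (C := Num.max C1 C2)) => //.
    + by rewrite ge_min lexx.
    + by rewrite le_max lexx.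
    + by rewrite le_max lexx orbT.
    + by rewrite mulr_gt0.
    + by rewrite mulrA.
    + by rewrite mulrA.
  - apply: (level_lt (theta := theta2) (C := Num.max C1 C2)) => //.
    + by rewrite ge_min lexx.
    + by rewrite le_max lexx.
    + by rewrite le_max lexx orbT.
    + by rewrite mulr_gt0.
    + by rewrite mulrA.
    + by rewrite mulrA.
  by exists (u, v).
(* One solution is selected for every [lambda]; the zero pair fills in at or below the threshold,
   which does not affect the limits. *)
have /choice[uv uvP] : forall lambda, exists uv,
    lambda_star < lambda -> solves lambda uv.
  move=> lambda; have [/sol[w H]|nstar] := pselect (lambda_star < lambda).
    by exists w.
  by exists (cst 0, cst 0) => /nstar.
have near_sol : \forall lambda \near +oo, solves lambda (uv lambda).
  by apply: filterS uvP _; apply: nbhs_pinfty_gt; exact: num_real.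
exists (fun lambda => (uv lambda).1), (fun lambda => (uv lambda).2); split.
- by move=> lambda /uvP[uv0 weak _ _]; split=> //; rewrite -surjective_pairing.
- apply: (@squeeze_cvgr _ _ _ _ (fun=> 0) (fun lambda =>
    `|p1 / (1 - p1 / beta1) * (2 * c lambda)| `^ p1^-1 +
    `|p2 / (1 - p2 / beta2) * (2 * c lambda)| `^ p2^-1)).
  + near=> lambda.
    have [_ _ E1 E2] : solves lambda (uv lambda) by near: lambda.
    apply/andP; split; first by rewrite addr_ge0 ?powR_ge0.
    by rewrite lerD // energy_le_root.
  + exact: cvg_cst.
  + by rewrite -[X in _ --> X](addr0 0); apply: cvgD; apply: root_cvg0.
- apply: (@squeeze_cvgr _ _ _ _ (fun=> 0) (fun lambda =>
    `|p1 / (mumin * h1min * (1 - p1 / beta1)) * (2 * c lambda)| `^ p1^-1 +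
    `|p2 / (mumin * h2min * (1 - p2 / beta2)) * (2 * c lambda)| `^ p2^-1)).
  + near=> lambda.
    have [_ _ E1 E2] : solves lambda (uv lambda) by near: lambda.
    apply/andP; split.
      have [y E] :=
        maxV_attained (fun y => enorm ((uv lambda).1 y) ((uv lambda).2 y)) x0.
      by rewrite /pair_supnorm E sqrtr_ge0.
    apply: (pair_supnorm_le x0) => y.
      exact: (vertex_le_energy y p1_gt1 mumin_gt0 h1min_gt0 (minV_le _)
        (minV_le _) b1_gt0 E1).
    exact: (vertex_le_energy y p2_gt1 mumin_gt0 h2min_gt0 (minV_le _)
      (minV_le _) b2_gt0 E2).
  + exact: cvg_cst.
  + by rewrite -[X in _ --> X](addr0 0); apply: cvgD; apply: root_cvg0.
Unshelve. all: by end_near. Qed.
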